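(* Let $q\in\mathbb{N}_0$. Then for each $n\in\mathbb{N}$ there exists a positive linear operator $M_n: C[0,1]\to\Pi_n$ which preserves $k$-monotonicity for every $0\le k\le q$ (i.e. $f\in\Delta^{(k)}$ implies $M_n(f,\cdot)\in\Delta^{(k)}$) and such that, for any $0\le\lambda<2$, $f\in C[0,1]$, $x\in[0,1]$ and $0<h\le c_0$, one has $$|f(x)-M_n(f,x)|\le c\left(1+\frac{\varphi^{2-\lambda}(x)}{h^2n^2\left(\varphi(x)+1/n\right)^{\lambda}}\right)\omega_2^{\varphi^\lambda}(f,h),$$ where $c_0>0$ is an absolute constant and the constant $c$ depends only on $q$ and on $\lambda$ as $\lambda\to2-$ (that is, $c$ does not depend on $n,f,x,h$, and for each $\lambda_1<2$ it can be chosen uniformly for $\lambda\in[0,\lambda_1]$).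
   Context: $\mathbb{N}=\{1,2,\dots\}$, $\mathbb{N}_0=\mathbb{N}\cup\{0\}$; $\Pi_n$ is the space of real algebraic polynomials of degree $\le n$; $\|\cdot\|$ is the sup norm on $[0,1]$; $\varphi(x):=\sqrt{x(1-x)}$. The $k$th symmetric difference of $f$ with step $\delta$ is $\Delta_\delta^k(f,x):=\sum_{i=0}^k\binom{k}{i}(-1)^{k-i}f(x-k\delta/2+i\delta)$, with $\Delta_\delta^k(f,x):=0$ if $x-k\delta/2\notin[0,1]$ or $x+k\delta/2\notin[0,1]$. A function $f\in C[0,1]$ is $k$-monotone if $\Delta_\delta^k(f,x)\ge0$ for all $\delta>0$ and all $x\in[0,1]$; $\Delta^{(k)}$ is the set of all $k$-monotone functions in $C[0,1]$ (so $\Delta^{(0)},\Delta^{(1)},\Delta^{(2)}$ are the nonnegative, nondecreasing and convex functions, respectively). For a function $\psi\ge0$ on $[0,1]$, the second Ditzian–Totik modulus is $\omega_2^\psi(f,t):=\sup_{0<h\le t}\|\Delta^2_{h\psi(\cdot)}(f,\cdot)\|$. Here $\varphi^\lambda(x)=(\varphi(x))^\lambda$. A linear operator $L$ on $C[0,1]$, whose value at $f$ is the function $x\mapsto L(f,x)$, is positive if $L(f,x)\ge0$ on $[0,1]$ whenever $f\ge0$ on $[0,1]$. *)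

(* Defs.v *)
From HB Require Import structures.
From mathcomp Require Import all_boot all_order all_algebra.
From mathcomp Require Import all_classical all_reals all_analysis.

Set Implicit Arguments.
Unset Strict Implicit.
Unset Printing Implicit Defensive.

Import Order.TTheory GRing.Theory Num.Theory.
Import numFieldNormedType.Exports.

Local Open Scope classical_set_scope.
Local Open Scope ring_scope.

(* An element of C[0,1] is represented by a total function R -> R that is
   continuous on [0,1] (for the subspace topology, hence one-sidedly at 0 and
   1); its values outside [0,1] are irrelevant. *)
Definition cont01 (R : realType) (f : R -> R) : Prop :=
  {within `[0, 1], continuous f}.

Definition phi (R : realType) (x : R) : R := Num.sqrt (x * (1 - x)).

(* [powR] satisfies 0 `^ 0 = 1 and 0 `^ a = 0 for a != 0. *)
Definition phi_pow (R : realType) (lambda x : R) : R := phi x `^ lambda.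

Definition symdiff (R : realType) (k : nat) (delta : R) (f : R -> R) (x : R)
    : R :=
  if (x - k%:R * delta / 2 \in `[0, 1]) && (x + k%:R * delta / 2 \in `[0, 1])
  then \sum_(i < k.+1) 'C(k, i)%:R * (-1) ^+ (k - i) *
         f (x - k%:R * delta / 2 + i%:R * delta)
  else 0.

Definition kmonotone (R : realType) (k : nat) (f : R -> R) : Prop :=
  cont01 f /\
  forall delta x : R, 0 < delta -> x \in `[0, 1] -> 0 <= symdiff k delta f x.

(* The real-valued [sup] is 0 on unbounded sets. This default never arises in
   [omega2 psi f t] for f in C[0,1] and t > 0: the differences are bounded by
   4 times the sup norm of f. *)
Definition supnorm01 (R : realType) (g : R -> R) : R :=
  sup [set `|g x| | x in `[0, 1]].

Definition omega2 (R : realType) (psi f : R -> R) (t : R) : R :=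
  sup [set supnorm01 (fun x => symdiff 2 (h * psi x) f x) | h in `]0, t]].

(* The first clause makes L an operator on C[0,1], i.e. independent of the
   values of its argument outside [0,1]. *)
Definition linear_on_C01 (R : realType) (L : (R -> R) -> {poly R}) : Prop :=
  (forall f g : R -> R, cont01 f -> cont01 g ->
     (forall x, x \in `[0, 1] -> f x = g x) -> L f = L g) /\
  (forall (a : R) (f g : R -> R), cont01 f -> cont01 g ->
     L (fun x => a * f x + g x) = a *: L f + L g).

Definition positive_on_C01 (R : realType) (L : (R -> R) -> {poly R}) : Prop :=
  forall f : R -> R, cont01 f ->
    (forall x, x \in `[0, 1] -> 0 <= f x) ->
    forall x, x \in `[0, 1] -> 0 <= (L f).[x].

(* Main.v *)
(* The operator is M_n f = T (B_N f), where B_N is the Bernstein operator with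
   N = n^2 nodes and T is a positive polynomial multiplier for the weight
   1/(x(1-x)).  On j-th derivatives (j >= 1) T acts through the kernel
     K_j(x,y) = sum_i Q^i F^(j-1+2i)(A) / (i! (i+j-1)!),
     A = xy + (1-x)(1-y),  Q = x(1-x)y(1-y),
   for one profile polynomial F of degree < n.  Up to a positive factor K_j is
   the average of F^(j-1)(A + 2 sqrt(Q) cos t) against sin^(2j-2) t, so it is
   nonnegative as soon as F^(j-1) >= 0 on [0,1], while a termwise computation
   gives d_x K_j w_j = - d_y (K_(j+1) w_(j+1)) with w_j = (y(1-y))^(j-1), i.e.
   differentiation intertwines the levels.  Hence M_n preserves k-monotonicity
   for k <= q when F, F', ..., F^(q) >= 0; it fixes linear functions, and
   x(1-x) is an eigenfunction with eigenvalue 1 - O(n^-2) when F is an iterated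
   primitive of the square of a Jacobi polynomial.

   For the estimate, let omega be the modulus of f and let v be a convex
   function whose second difference with step h phi^lambda(u) at u is at least
   1.  By a discrete maximum principle f - omega v is concave, and f + omega v
   is convex, up to an error omega, so |f(x) - M_n f(x)| is at most
   omega (1 + M_n v(x) - v(x)).  A suitable v, adapted to the scale
   max(x, n^-2), turns the second moment O(x(1-x)/n^2) into the stated bound. *)

Require Import Defs.
From HB Require Import structures.
From mathcomp Require Import all_boot all_order all_algebra.
From mathcomp Require Import all_classical all_reals all_analysis.
From mathcomp Require Import ring lra zify.
Set Implicit Arguments.
Unset Strict Implicit.
Unset Printing Implicit Defensive.
Import Order.TTheory GRing.Theory Num.Theory.
Import numFieldNormedType.Exports.
Local Open Scope classical_set_scope.
Local Open Scope ring_scope.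

(** Two requirements conflict: a Bernstein operator with error of order n^-2 needs about n^2 nodes,
    hence degree n^2, while degree n is allowed. The composition with T resolves this, because the
    degree of T p is bounded through F alone, whatever the degree of p. The Bernstein step also
    turns k-monotonicity of a merely continuous f into the sign of a k-th derivative, so that T only
    has to act on polynomials.

    No analytic integration is involved on the multiplier side. Integrals over [0,1] are a linear
    functional on coefficients, valid over any ring where positive integers are invertible, in
    particular over polynomials in x. The average over t is a finite mean over N equally spaced
    angles, which is exact for trigonometric degree below N.

    On the estimate side, T composed with the Bernstein operator is, at a fixed x, a finite mean
    with nonnegative weights. Only its mass, barycentre and second moment are used afterwards. *)

(** * Derivations vanishing on scalars *)

Record derivation (R : comNzRingType) (S : comNzRingType) (c : {rmorphism R -> S}) := Derivation {
  dfun :> S -> S;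
  derivationD : forall p q, dfun (p + q) = dfun p + dfun q;
  derivationM : forall p q, dfun (p * q) = dfun p * q + p * dfun q;
  derivationC : forall a, dfun (c a) = 0 }.

Section Derivations.
Variables (R S : comNzRingType) (c : {rmorphism R -> S}) (d : derivation c).

Lemma derivation0 : d 0 = 0.
Proof. by rewrite -[X in d X](rmorph0 c) derivationC. Qed.
Lemma derivation1 : d 1 = 0.
Proof. by rewrite -[X in d X](rmorph1 c) derivationC. Qed.
Lemma derivationN p : d (- p) = - d p.
Proof. by apply/eqP; rewrite -subr_eq0 opprK -derivationD addNr derivation0. Qed.
Lemma derivation_sum I (r : seq I) (P : pred I) F :
  d (\sum_(i <- r | P i) F i) = \sum_(i <- r | P i) d (F i).
Proof. exact: (big_morph d (derivationD d) derivation0). Qed.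
Lemma derivationX p n : d (p ^+ n) = p ^+ n.-1 * d p *+ n.
Proof.
elim: n => [|n IH]; first by rewrite expr0 derivation1 mulr0n.
rewrite exprS derivationM IH /=; case: n {IH} => [|n].
  by rewrite expr0 mulr0n mulr0 addr0 mulr1 mul1r mulr1n.
by rewrite mulrnAr /= mulrA -exprS mulrC -mulrS.
Qed.
Definition ev (G : {poly R}) (A : S) : S := (map_poly c G).[A].
Lemma derivation_ev G A : d (ev G A) = ev G^`() A * d A.
Proof.
rewrite /ev; elim/poly_ind: G => [|G a IH].
  by rewrite deriv0 !rmorph0 !horner0 mul0r derivation0.
rewrite derivD derivM derivX derivC addr0 mulr1 !rmorphD !rmorphM /= map_polyX map_polyC !hornerE.
by rewrite derivationD derivationM derivationC IH; ring.
Qed.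
End Derivations.


(** * The kernels and their intertwining identity *)

Section Kernel.
Variables (R : numFieldType) (S : comNzRingType) (c : {rmorphism R -> S}).
Implicit Types (F : {poly R}) (x y : S).

(** For positive [j] these are the coefficients of the modified Bessel function I_(j-1). Its Poisson
    integral, with exp replaced by a polynomial, is the model for the positivity of the kernels. *)
Definition kercoef (j i : nat) : R := ((i`! * (i + j.-1)`!)%N%:R)^-1.

Definition kerA (x y : S) := x * y + (1 - x) * (1 - y).
Definition kerQ (x y : S) := x * (1 - x) * (y * (1 - y)).

(** The argument [F] stands for the (j-1)-st derivative of the profile; that shift is left to the
    caller. The bound [size F] cuts off only vanishing terms. *)
Definition kern (j : nat) F x y : S :=
  \sum_(i < size F) c (kercoef j i) * (kerQ x y ^+ i * ev c F^`(i.*2) (kerA x y)).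

Lemma kern_widen N j F x y : (size F <= N)%N ->
  kern j F x y =
  \sum_(i < N) c (kercoef j i) * (kerQ x y ^+ i * ev c F^`(i.*2) (kerA x y)).
Proof.
move=> leN; rewrite /kern (big_ord_widen N (fun i => c (kercoef j i) * (kerQ x y ^+ i * ev c F^`(i.*2) (kerA x y)))) // big_mkcond.
apply: eq_bigr => i _; case: ltnP => // lei.
have -> : F^`(i.*2) = 0 by apply/derivn_poly0/(leq_trans lei); rewrite -addnn leq_addr.
by rewrite /ev rmorph0 horner0 !mulr0.
Qed.

Lemma kernC j F x y : kern j F x y = kern j F y x.
Proof.
have eQ : kerQ x y = kerQ y x by rewrite /kerQ; ring.
have eA : kerA x y = kerA y x by rewrite /kerA; ring.
by rewrite /kern eQ eA.
Qed.

Lemma kercoefS j i : (0 < j)%N -> (i.+1)%:R * kercoef j i.+1 = kercoef j.+1 i.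
Proof.
case: j => // j _.
by rewrite /kercoef /= factS addSnnS !natrM !invfM !mulrA mulfV ?mul1r ?pnatr_eq0.
Qed.

Lemma kercoefD j i : (0 < j)%N -> (i + j)%:R * kercoef j.+1 i = kercoef j i.
Proof.
case: j => // j _.
by rewrite /kercoef /= addnS factS !natrM !invfM mulrCA mulVKf ?pnatr_eq0.
Qed.

Variables (d1 d2 : derivation c) (x y : S).
Hypotheses (d1x : d1 x = 1) (d1y : d1 y = 0) (d2x : d2 x = 0) (d2y : d2 y = 1).

(** The derivations are abstract so that the same identity serves with the two variables exchanged,
    which the multiplier needs at level 0. *)
Lemma kern_deriv j F : (0 < j)%N ->
  d1 (kern j F x y) * (y * (1 - y)) ^+ j.-1 =
  - d2 (kern j.+1 F^`() x y * (y * (1 - y)) ^+ j).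
Proof.
case: j => // j _ /=.
have d1B : d1 (1 - x) = -1 by rewrite derivationD derivationN derivation1 d1x; ring.
have d1B' : d1 (1 - y) = 0 by rewrite derivationD derivationN derivation1 d1y; ring.
have d2B : d2 (1 - y) = -1 by rewrite derivationD derivationN derivation1 d2y; ring.
have d2B' : d2 (1 - x) = 0 by rewrite derivationD derivationN derivation1 d2x; ring.
have d1A : d1 (kerA x y) = y - (1 - y).
  by rewrite /kerA derivationD !derivationM d1B d1x d1y d1B'; ring.
have d2A : d2 (kerA x y) = x - (1 - x).
  by rewrite /kerA derivationD !derivationM d2B d2x d2y d2B'; ring.
have d1Q : d1 (kerQ x y) = (1 - x - x) * (y * (1 - y)).
  by rewrite /kerQ !derivationM d1B d1B' d1x d1y; ring.
have d2Q : d2 (kerQ x y) = (1 - y - y) * (x * (1 - x)).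
  by rewrite /kerQ !derivationM d2B d2B' d2x d2y; ring.
set A := kerA x y; set Q := kerQ x y; set w := y * (1 - y).
set v := x * (1 - x).
have QE : Q = v * w by [].
have d2w : d2 w = 1 - y - y by rewrite /w derivationM d2y d2B; ring.
pose P k := ev c F^`(k) A.
have dP (d : derivation c) k : d (P k) = P k.+1 * d A.
  by rewrite /P derivation_ev -derivnS.
have PN k : (size F <= k)%N -> P k = 0.
  by move=> lek; rewrite /P derivn_poly0 // /ev rmorph0 horner0.
have -> : kern j.+1 F x y =
    \sum_(i < (size F).+1) c (kercoef j.+1 i) * (Q ^+ i * P i.*2).
  exact: kern_widen (leqnSn _).
have -> : kern j.+2 F^`() x y =
    \sum_(i < size F) c (kercoef j.+2 i) * (Q ^+ i * P i.*2.+1).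
  rewrite (@kern_widen (size F)); last exact: leq_trans (size_poly _ _) (leq_pred _).
  by apply: eq_bigr => i _; rewrite -derivSn derivnS.
rewrite derivation_sum.
under eq_bigr => i _ do rewrite !derivationM derivationC mul0r add0r derivationX dP d1A d1Q mulrDr.
(* The part that differentiates Q loses its first term, and the part that differentiates A loses its
   last, whose derivative of [F] is zero. After this shift the sums match index by index through
   [kercoefS] and [kercoefD]. *)
rewrite big_split /= big_ord_recl /= mulr0n !mul0r mulr0 add0r.
rewrite [\sum_(i < (size F).+1) _]big_ord_recr /= [P (size F).*2.+1]PN; last first.
  by rewrite -addnn -addSn leq_addl.
rewrite !mul0r !mulr0 addr0 mulr_suml derivation_sum -sumrN -big_split /= mulr_suml.
apply: eq_bigr => i _.
have e1 : c (kercoef j.+1 (lift ord0 i)) *+ i.+1 = c (kercoef j.+2 i).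
  by rewrite -(kercoefS i (ltn0Sn j)) mulr_natl rmorphMn.
have e2 : c (kercoef j.+1 i) = c (kercoef j.+2 i) *+ (i + j.+1).
  by rewrite -(kercoefD i (ltn0Sn j)) mulr_natl rmorphMn.
rewrite !derivationM derivationC !derivationX d2w dP d2A d2Q /= /bump /= add1n doubleS.
move: e1 e2; rewrite /= /bump /= add1n => e1 e2.
rewrite add0n -/w -/v (mulrnAl (Q ^+ i * _)) mulrnAr -(mulrnAl (c _)) e1 e2.
rewrite exprS; case: (nat_of_ord i) => [|k] /=.
  rewrite !expr0 mulr0n add0n; ring.
rewrite QE !exprS /= addSn; ring.
Qed.
End Kernel.

(** * The integral over [0,1] as a functional on coefficients *)

Section Integral.
Variable A : comUnitRingType.
Implicit Types (p q : {poly A}).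

(** Coefficients in a unit ring rather than a field: the integral in y of a bivariate polynomial is
    then a polynomial in x. *)
Definition integ p : A := \sum_(i < size p) p`_i / i.+1%:R.

Lemma integ_widen N p : (size p <= N)%N -> integ p = \sum_(i < N) p`_i / i.+1%:R.
Proof.
move=> leN; rewrite /integ (big_ord_widen N (fun i => p`_i / i.+1%:R)) //.
rewrite big_mkcond; apply: eq_bigr => i _; case: ltnP => // lei.
by rewrite nth_default ?mul0r.
Qed.

Lemma integD p q : integ (p + q) = integ p + integ q.
Proof.
rewrite !(@integ_widen (maxn (size p) (size q))) ?leq_maxl ?leq_maxr ?size_polyD //.
by rewrite -big_split; apply: eq_bigr => i _; rewrite coefD mulrDl.
Qed.

Lemma integZ a p : integ (a%:P * p) = a * integ p.
Proof.
rewrite mul_polyC !(@integ_widen (size p)) ?size_scale_leq // mulr_sumr.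
by apply: eq_bigr => i _; rewrite coefZ mulrA.
Qed.

Lemma integ0 : integ 0 = 0.
Proof. by rewrite /integ size_poly0 big_ord0. Qed.

Lemma integN p : integ (- p) = - integ p.
Proof. by apply/eqP; rewrite -addr_eq0 -integD addNr integ0. Qed.

Hypothesis A_nat_unit : forall i, (i.+1%:R : A) \is a GRing.unit.

Lemma integ_deriv p : integ p^`() = p.[1] - p.[0].
Proof.
rewrite (@integ_widen (size p).-1) ?size_poly //.
rewrite horner_coef0 horner_coef; case: (posnP (size p)) => [p0|p_gt0].
  rewrite p0 !big_ord0; move/eqP: p0; rewrite size_poly_eq0 => /eqP->.
  by rewrite coef0 subrr.
rewrite -(prednK p_gt0) big_ord_recl /= expr0 mulr1 addrC addKr.
apply: eq_bigr => i _; rewrite coef_deriv expr1n mulr1 /bump /= add1n.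
by rewrite -(mulr_natr p`_i.+1) mulrK.
Qed.

Lemma integ_deriv0 p : p.[0] = 0 -> p.[1] = 0 -> integ p^`() = 0.
Proof. by move=> p0 p1; rewrite integ_deriv p0 p1 subrr. Qed.
End Integral.

Lemma integ_map (A B : comUnitRingType) (f : {rmorphism A -> B}) (p : {poly A}) :
  (forall i, (i.+1%:R : A) \is a GRing.unit) ->
  f (integ p) = integ (map_poly f p).
Proof.
move=> unitA; rewrite (@integ_widen _ (size p) (map_poly f p)) ?size_poly //.
rewrite rmorph_sum /=; apply: eq_bigr => i _.
by rewrite rmorph_div // rmorph_nat coef_map.
Qed.

Lemma natr_unit (R : numFieldType) i : (i.+1%:R : R) \is a GRing.unit.
Proof. by rewrite unitfE pnatr_eq0. Qed.

Lemma natr_poly_unit (R : numFieldType) i : (i.+1%:R : {poly R}) \is a GRing.unit.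
Proof. by rewrite -polyC_natr poly_unitE size_polyC pnatr_eq0 /= coefC eqxx natr_unit. Qed.

(** * The polynomial multiplier and its derivatives *)

Section Bivariate.
Variable R : numFieldType.
Local Notation S := {poly {poly R}}.
Implicit Types (F g p : {poly R}).

Definition cc : {rmorphism R -> S} := (polyC \o polyC : {rmorphism R -> S}).

(** The outer variable is y and the inner one x, so the x-derivative acts on coefficients. *)
Definition dX_fun (p : S) : S := map_poly (fun q : {poly R} => q^`()) p.

Lemma coef_dX (p : S) i : (dX_fun p)`_i = (p`_i)^`().
Proof. by rewrite coef_map_id0 // deriv0. Qed.

Fact dX_D (p q : S) : dX_fun (p + q) = dX_fun p + dX_fun q.
Proof. by apply/polyP => i; rewrite coefD !coef_dX coefD derivD. Qed.
Fact dX_M (p q : S) : dX_fun (p * q) = dX_fun p * q + p * dX_fun q.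
Proof.
apply/polyP => i; rewrite coefD !coefM coef_dX coefM raddf_sum -big_split.
by apply: eq_bigr => j _; rewrite /= derivM !coef_dX.
Qed.
Fact dX_C a : dX_fun (cc a) = 0.
Proof.
by apply/polyP => i; rewrite coef_dX coefC coef0; case: eqP => _; rewrite ?derivC ?deriv0.
Qed.
Definition dX : derivation cc := Derivation dX_D dX_M dX_C.

Fact dY_C a : (cc a : S)^`() = 0.
Proof. exact: derivC. Qed.
Definition dY : derivation cc := Derivation (@derivD _) (@derivM _) dY_C.

Lemma deriv_integ (p : S) : (integ p)^`() = integ (dX p).
Proof.
rewrite (@integ_widen _ (size p) (dX p)) ?size_poly // raddf_sum.
apply: eq_bigr => i _; rewrite /= derivM coef_dX -polyC_natr.
have -> : ((i.+1%:R)%:P)^-1 = (i.+1%:R^-1)%:P :> {poly R} by rewrite polyCV.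
by rewrite derivC mulr0 addr0.
Qed.

Definition vX : S := 'X%:P.
Definition vY : S := 'X.
Definition inY g : S := map_poly polyC g.

Lemma dXX : dX vX = 1. Proof. by apply/polyP => i; rewrite coef_dX coefC coef1; case: eqP; rewrite ?derivX ?deriv0. Qed.
Lemma dYX : dY vX = 0. Proof. exact: derivC. Qed.
Lemma dXY : dX vY = 0. Proof. by apply/polyP => i; rewrite coef_dX coefX coef0; case: eqP; rewrite ?derivC ?deriv0. Qed.
Lemma dYY : dY vY = 1. Proof. exact: derivX. Qed.
Lemma dX_inY g : dX (inY g) = 0.
Proof. by apply/polyP => i; rewrite coef_dX coef_map coef0 derivC. Qed.
Lemma dY_inY g : dY (inY g) = inY g^`().
Proof. by rewrite /= deriv_map. Qed.

Definition wY : S := vY * (1 - vY).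
Definition wX : S := vX * (1 - vX).

Definition Kop j F g : {poly R} := integ (kern cc j F vX vY * inY g * wY ^+ j.-1).

Lemma dX_wYn n : dX (wY ^+ n) = 0.
Proof.
by rewrite derivationX /wY derivationM derivationD derivationN derivation1 dXY; ring.
Qed.

(** Differentiation under the integral, exchange of the x-derivative for a y-derivative by
    [kern_deriv], then integration by parts. The boundary terms vanish because the weight y(1-y)
    occurs to the positive power j. *)
Lemma Kop_deriv j F g : (0 < j)%N -> (Kop j F g)^`() = Kop j.+1 F^`() g^`().
Proof.
move=> j_gt0; rewrite /Kop deriv_integ.
have -> : dX (kern cc j F vX vY * inY g * wY ^+ j.-1) =
    dX (kern cc j F vX vY) * wY ^+ j.-1 * inY g.
  by rewrite !derivationM dX_inY dX_wYn; ring.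
rewrite (kern_deriv dXX dXY dYX dYY) // -/wY /=.
set K := kern _ _ _ _ _.
have /(congr1 (@integ _)) : dY (K * wY ^+ j * inY g) =
  dY (K * wY ^+ j) * inY g + K * inY g^`() * wY ^+ j.
  by rewrite derivationM dY_inY; ring.
have w0 : (wY ^+ j).[0] = 0 by rewrite horner_exp hornerM hornerX mul0r expr0n gtn_eqF.
have w1 : (wY ^+ j).[1] = 0 by rewrite horner_exp hornerM hornerD hornerN hornerX hornerC subrr mulr0 expr0n gtn_eqF.
rewrite integ_deriv0; first last.
- by rewrite !hornerM w1 mulr0 mul0r.
- by rewrite !hornerM w0 mulr0 mul0r.
- exact: natr_poly_unit.
rewrite integD => /eqP; rewrite eq_sym addrC addr_eq0 => /eqP ->.
by rewrite mulNr integN.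
Qed.

Lemma Kop_derivn j F g n : (0 < j)%N ->
  (Kop j F g)^`(n) = Kop (j + n) F^`(n) g^`(n).
Proof.
move=> j0; elim: n => [|n IH]; first by rewrite addn0.
by rewrite !derivnS IH Kop_deriv ?addnS // addn_gt0 j0.
Qed.

Lemma kern0 j (x y : S) : kern cc j 0 x y = 0.
Proof. by rewrite /kern size_poly0 big_ord0. Qed.
Lemma Kop0l j g : Kop j 0 g = 0.
Proof. by rewrite /Kop kern0 !mul0r integ0. Qed.
Lemma Kop0r j F : Kop j F 0 = 0.
Proof. by rewrite /Kop /inY rmorph0 mulr0 mul0r integ0. Qed.

Definition prim p : {poly R} := \poly_(i < (size p).+1) (p`_i.-1 / i%:R).

Lemma deriv_prim p : (prim p)^`() = p.
Proof.
apply/polyP => i; rewrite coef_deriv coef_poly ltnS; case: ltnP => [_|lei].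
  by rewrite /= -(mulr_natr (_ / _)) mulfVK // pnatr_eq0.
by rewrite mul0rn nth_default.
Qed.

Lemma prim_0 p : (prim p).[0] = 0.
Proof. by rewrite horner_coef0 coef_poly /= invr0 mulr0. Qed.

Lemma prim_1 p : (prim p).[1] = integ p.
Proof. by rewrite -[in RHS](deriv_prim p) integ_deriv ?prim_0 ?subr0 //; exact: natr_unit. Qed.

Lemma prim_uniq p P : P^`() = p -> P.[0] = 0 -> P = prim p.
Proof.
move=> dP P0; apply/polyP => -[|i]; first by rewrite -!horner_coef0 P0 prim_0.
have /(congr1 (fun q : {poly R} => q`_i)) : P^`() = (prim p)^`() by rewrite deriv_prim.
rewrite !coef_deriv -(mulr_natr P`_i.+1) -(mulr_natr (prim p)`_i.+1).
by apply: mulIf; rewrite pnatr_eq0.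
Qed.

Lemma kern_Q0 (S' : comNzRingType) (c : {rmorphism R -> S'}) F x y :
  kerQ x y = 0 -> kern c 1 F x y = ev c F (kerA x y).
Proof.
move=> Q0; rewrite (@kern_widen _ _ _ (size F).+1) // big_ord_recl big1 => [|i _].
  rewrite /= expr0 /kercoef /= fact0 muln1 invr1 rmorph1 !mul1r addr0 //.
by rewrite Q0 exprS !mul0r mulr0.
Qed.

Lemma kern_map (S1 S2 : comNzRingType) (f : {rmorphism S1 -> S2})
    (c1 : {rmorphism R -> S1}) (c2 : {rmorphism R -> S2}) j F x y :
  (forall a, f (c1 a) = c2 a) ->
  f (kern c1 j F x y) = kern c2 j F (f x) (f y).
Proof.
move=> fc; rewrite rmorph_sum; apply: eq_bigr => i _.
rewrite !rmorphM rmorphXn fc /ev -horner_map -map_poly_comp /=.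
congr (_ * (_ ^+ _ * _.[_])).
- by rewrite /kerQ !rmorphM !rmorphB !rmorph1.
- by apply: eq_map_poly => a; rewrite /= fc.
- by rewrite /kerA rmorphD !rmorphM !rmorphB !rmorph1.
Qed.

Lemma kern_horner j F (a : {poly R}) :
  (kern cc j F vX vY).[a] = kern polyC j F 'X a.
Proof.
rewrite -/(horner_eval a _) (@kern_map _ _ _ _ polyC) /= /horner_eval ?hornerC ?hornerX //.
by move=> r; rewrite hornerC.
Qed.

Lemma kern1_at1 F : (kern cc 1 F vX vY).[1] = F.
Proof.
rewrite kern_horner kern_Q0; last by rewrite /kerQ; ring.
by rewrite /ev /kerA subrr mulr0 addr0 mulr1 -/(comp_poly _ _) comp_polyXr.
Qed.

Lemma kern1_at0 F : (kern cc 1 F vX vY).[0] = F \Po (1 - 'X).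
Proof.
rewrite kern_horner kern_Q0; last by rewrite /kerQ; ring.
by rewrite /ev /kerA mulr0 add0r subr0 mulr1.
Qed.

(** This is the antiderivative of the level 1 operator applied to p', integrated by parts until no
    derivative of [p] remains. In this form the positivity at level 0 is visible. *)
Definition Op F p : {poly R} :=
  p.[0] *: (prim F \Po (1 - 'X)) + p.[1] *: prim F +
  'X * (1 - 'X) * integ (kern cc 2 F^`() vX vY * inY p).

Lemma inY_horner p a : (inY p).[a%:P] = p.[a]%:P.
Proof. by rewrite /inY horner_map. Qed.

Lemma Op_deriv F p : (Op F p)^`() = Kop 1 F p^`().
Proof.
rewrite /Op !derivD !derivZ deriv_comp !deriv_prim.
have -> : (1 - 'X : {poly R})^`() = -1 by rewrite derivB derivX -[1]/(1%:P) derivC sub0r.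
have -> : 'X * (1 - 'X) * integ (kern cc 2 F^`() vX vY * inY p) =
    integ (wX * (kern cc 2 F^`() vX vY * inY p)).
  by rewrite -integZ /wX /vX polyCM polyCB.
rewrite deriv_integ.
have -> : dX (wX * (kern cc 2 F^`() vX vY * inY p)) = - dY (kern cc 1 F vX vY * inY p)
    + kern cc 1 F vX vY * inY p^`() * wY ^+ 0.
  (* The kernel is symmetric, so the identity also holds with x and y exchanged; the factor x(1-x)
     in [Op] is the weight that it asks for. *)
  have := kern_deriv dYY dYX dXY dXX F (isT : (0 < 1)%N).
  rewrite !expr0 expr1 mulr1 -/wX !(kernC _ _ _ vY) => eK.
  have -> : wX * (kern cc 2 F^`() vX vY * inY p) =
      kern cc 2 F^`() vX vY * wX * inY p by ring.
  rewrite derivationM dX_inY [dY (_ * inY p)]derivationM dY_inY eK; ring.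
rewrite integD integN integ_deriv; last exact: natr_poly_unit.
rewrite !hornerM kern1_at1 kern1_at0 (inY_horner p 1) (inY_horner p 0).
rewrite -!mul_polyC /Kop /=; ring.
Qed.

Lemma Op_at0 F p : integ F = 1 -> (Op F p).[0] = p.[0].
Proof.
move=> F1; rewrite /Op !hornerE horner_comp !hornerE subr0 prim_1 F1 prim_0; ring.
Qed.
Lemma Op_at1 F p : integ F = 1 -> (Op F p).[1] = p.[1].
Proof.
move=> F1; rewrite /Op !hornerE horner_comp !hornerE subrr prim_1 F1 prim_0; ring.
Qed.

Lemma Op_linear F a p q : Op F (a *: p + q) = a *: Op F p + Op F q.
Proof.
have inYD : inY (a *: p + q) = a%:P%:P * inY p + inY q.
  by rewrite /inY rmorphD /= -mul_polyC rmorphM /= map_polyC.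
rewrite /Op inYD; set K := kern _ _ _ _ _.
have -> : K * (a%:P%:P * inY p + inY q) = a%:P%:P * (K * inY p) + K * inY q by ring.
rewrite integD integZ !hornerD !hornerZ -!mul_polyC; ring.
Qed.

Lemma Op_derivn F p k : (0 < k)%N -> (Op F p)^`(k) = Kop k F^`(k.-1) p^`(k).
Proof.
case: k => // k _; rewrite derivSn Op_deriv Kop_derivn // add1n /=.
by rewrite -derivSn.
Qed.

Lemma size_derivn0 p k : p^`(k) = 0 -> (size p <= k)%N.
Proof.
move=> pk; apply/leq_sizeP => i lei.
have := congr1 (fun q : {poly R} => q`_(i - k)) pk.
rewrite coef_derivn coef0 subnKC // => /eqP.
by rewrite -mulr_natr mulf_eq0 pnatr_eq0 eqn0Ngt ffact_gt0 lei orbF => /eqP.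
Qed.

(** The derivative of order n+1 involves only the n-th derivative of [F], which is zero. The degree
    of [p] does not enter, which leaves the number of Bernstein nodes free. *)
Lemma size_Op F p n : (size F <= n)%N -> (size (Op F p) <= n.+1)%N.
Proof.
by move=> szF; apply: size_derivn0; rewrite Op_derivn // (derivn_poly0 szF) Kop0l.
Qed.

Lemma poly_eq_deriv p q : p^`() = q^`() -> p.[0] = q.[0] -> p = q.
Proof.
move=> e e0; apply/eqP; rewrite -subr_eq0; apply/eqP.
rewrite (@prim_uniq 0 (p - q)); first by apply/esym/prim_uniq; rewrite ?deriv0 ?horner0.
  by rewrite derivB e subrr.
by rewrite !hornerE e0 subrr.
Qed.

Lemma map_horner_inY a g : map_poly (horner_eval a) (inY g) = g.
Proof. by apply/polyP => i; rewrite !coef_map /= /horner_eval hornerC. Qed.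

Lemma Kop1_at1 F g : (Kop 1 F g).[1] = integ (F * g).
Proof.
rewrite /Kop -/(horner_eval 1 _) integ_map; last exact: natr_poly_unit.
rewrite !rmorphM rmorphXn /= expr0 mulr1.
rewrite map_horner_inY; congr (integ (_ * _)).
rewrite (@kern_map _ _ _ _ polyC); last first.
  by move=> a; rewrite /= map_polyC /= /horner_eval hornerC.
rewrite /= /vX /vY map_polyC map_polyX /= /horner_eval hornerX.
rewrite kern_Q0; last by rewrite /kerQ; ring.
by rewrite /ev /kerA subrr mul0r addr0 mul1r -/(comp_poly _ _) comp_polyXr.
Qed.

Lemma Kop1_at0 F g : (Kop 1 F g).[0] = integ ((F \Po (1 - 'X)) * g).
Proof.
rewrite /Kop -/(horner_eval 0 _) integ_map; last exact: natr_poly_unit.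
rewrite !rmorphM rmorphXn /= expr0 mulr1.
rewrite map_horner_inY; congr (integ (_ * _)).
rewrite (@kern_map _ _ _ _ polyC); last first.
  by move=> a; rewrite /= map_polyC /= /horner_eval hornerC.
rewrite /= /vX /vY map_polyC map_polyX /= /horner_eval hornerX.
rewrite kern_Q0; last by rewrite /kerQ; ring.
by rewrite /ev /kerA mul0r add0r subr0 mul1r.
Qed.

Lemma Op_const F a : integ F = 1 -> Op F a%:P = a%:P.
Proof.
move=> F1; apply: poly_eq_deriv; last exact: Op_at0.
by rewrite Op_deriv derivC Kop0r.
Qed.

Lemma Kop1_one F : integ F = 1 -> Kop 1 F 1 = 1.
Proof.
move=> F1.
have dK : (Kop 1 F 1)^`() = 0 by rewrite Kop_deriv // -[1]/(1%:P) derivC Kop0r.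
have /size1_polyC eK := size_derivn0 (dK : (Kop 1 F 1)^`(1) = 0).
by have := Kop1_at1 F 1; rewrite eK hornerC mulr1 F1 => ->.
Qed.

Lemma Op_X F : integ F = 1 -> Op F 'X = 'X.
Proof.
move=> F1; apply: poly_eq_deriv; last exact: Op_at0.
by rewrite Op_deriv derivX Kop1_one.
Qed.

Lemma integ_flip p : integ (p \Po (1 - 'X)) = integ p.
Proof.
have -> : p \Po (1 - 'X) = (- (prim p \Po (1 - 'X)))^`().
  by rewrite derivN deriv_comp deriv_prim derivB derivX -[1]/(1%:P) derivC; ring.
rewrite integ_deriv; last exact: natr_unit.
rewrite !hornerN !horner_comp !hornerE subrr subr0 prim_1 prim_0; ring.
Qed.

(** After one differentiation the claim is that 1-2x is an eigenvector at level 1. Its image has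
    vanishing second derivative, so it is affine and determined by its values at 0 and 1, which are
    opposite by the reflection x to 1-x. *)
Lemma Op_X1X F : integ F = 1 ->
  Op F ('X * (1 - 'X)) = (1 - integ (F * (1 - 'X)) *+ 2) *: ('X * (1 - 'X)).
Proof.
move=> F1; set mu := 1 - integ _ *+ 2.
have dg : ('X * (1 - 'X) : {poly R})^`() = 1 - 2%:P * 'X.
  rewrite derivM derivX derivB derivX -[1]/(1%:P) derivC; ring.
have ddg : (1 - 2%:P * 'X : {poly R})^`() = (- 2)%:P.
  by rewrite derivB derivM derivX -[1]/(1%:P) !derivC polyCN; ring.
have K2const : (Kop 1 F (1 - 2%:P * 'X))^`(2) = 0.
  by rewrite Kop_derivn // !derivnS derivn0 ddg derivC Kop0r.
have eF : integ (F * (1 - 2%:P * 'X)) = - mu.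
  have -> : F * (1 - 2%:P * 'X) = 2%:P * (F * (1 - 'X)) - F by ring.
  by rewrite integD integN integZ F1 /mu; ring.
have eF' : integ ((F \Po (1 - 'X)) * (1 - 2%:P * 'X)) = mu.
  rewrite -integ_flip comp_polyM -comp_polyA.
  have -> : (1 - 'X) \Po (1 - 'X) = 'X :> {poly R} by rewrite !comp_polyB comp_polyX comp_polyC; ring.
  rewrite comp_polyXr !(comp_polyB, comp_polyM, comp_polyX, comp_polyC).
  have -> : F * (1 - 2%:P * (1 - 'X)) = - (F * (1 - 2%:P * 'X)) by ring.
  by rewrite integN eF opprK.
have Kg : Kop 1 F (1 - 2%:P * 'X) = mu *: (1 - 2%:P * 'X).
  have sz := size_derivn0 K2const.
  have := Kop1_at1 F (1 - 2%:P * 'X); have := Kop1_at0 F (1 - 2%:P * 'X).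
  rewrite eF eF'; set p := Kop _ _ _ in sz *.
  have -> : p = (p`_0)%:P + (p`_1)%:P * 'X.
    apply/polyP => -[|[|i]]; rewrite coefD coefC coefCM coefX /= ?mulr0 ?mulr1 ?addr0 ?add0r //.
    by rewrite nth_default // (leq_trans sz).
  move: (p`_0) (p`_1) => a b; rewrite !hornerE => e0 e1.
  have ea : a = mu by rewrite -e0; ring.
  have -> : b = - mu - a by rewrite -e1; ring.
  by rewrite ea; move: (mu) => m; rewrite -mul_polyC polyCD polyCN; ring.
apply: poly_eq_deriv.
  by rewrite Op_deriv dg Kg derivZ dg.
by rewrite Op_at0 // hornerZ !hornerE; ring.
Qed.
End Bivariate.

(* [walk m r] / 2^m is the mean of cos^m t cos(r t) over a period: a factor
   2 cos t sends cos(r t) to the sum of its two neighbours, folded at r = 0. *)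
Fixpoint walk (m r : nat) : nat :=
  match m with
  | 0 => r == 0
  | m'.+1 => if r is r'.+1 then walk m' r'.+2 + walk m' r' else (walk m' 1).*2
  end.

Lemma walk_out m r : (m < r)%N -> walk m r = 0%N.
Proof. by elim: m r => [|m IH] [|r] //= lt; rewrite !IH //; lia. Qed.

Lemma walk_bin m r l : m = (r + l.*2)%N -> walk m r = 'C(m, l).
Proof.
elim: m r l => [|m IH] [|r] l //=; first by case: l.
  case: l => [|l] //; rewrite add0n doubleS => -[em].
  rewrite (IH 1%N l) ?add1n // binS -(@bin_sub m l.+1); last by lia.
  by rewrite -addnn; congr ('C(_, _) + _)%N; lia.
rewrite addSn => -[em]; rewrite (IH r l em).
case: l em => [|l] em; first by rewrite walk_out ?bin0 //; lia.
have em' : m = (r.+2 + l.*2)%N by rewrite em doubleS; lia.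
by rewrite (IH _ _ em') binS addnC.
Qed.

Lemma walk_odd m r : odd (m + r) -> walk m r = 0%N.
Proof. by elim: m r => [|m IH] [|r] //= o; rewrite !IH //; lia. Qed.

(** * Exact trigonometric means over equally spaced angles *)

Section RootsOfUnity.
Variables (R : realType) (N : nat).

Definition ang (k : nat) : R := 2 * pi * k%:R / N%:R.

(** Multiplication by 2 sin(pi r / N), nonzero for 0 < r < N, makes the sum telescope over a full
    period. *)
Lemma sum_cos r : (0 < r)%N -> (r < N)%N -> \sum_(k < N) cos (r%:R * ang k) = 0.
Proof.
move=> r0 rN; have N0 : N%:R != 0 :> R by rewrite pnatr_eq0; lia.
set a : R := pi * r%:R / N%:R.
have sa : sin a != 0.
  rewrite gt_eqF // sin_gt0_pi // /a; apply/andP; split.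
    by rewrite divr_gt0 ?mulr_gt0 ?pi_gt0 ?ltr0n //; lia.
  rewrite ltr_pdivrMr ?ltr0n; last by lia.
  by rewrite ltr_pM2l ?pi_gt0 // ltr_nat.
pose u k : R := sin (a * (k%:R *+ 2 - 1)).
have tele k : 2 * sin a * cos (r%:R * ang k) = u k.+1 - u k.
  have -> : r%:R * ang k = a * k%:R *+ 2 by rewrite /ang /a; field.
  have e1 : a * (k.+1%:R *+ 2 - 1) = a * k%:R *+ 2 + a by rewrite -natr1; ring.
  have e2 : a * (k%:R *+ 2 - 1) = a * k%:R *+ 2 - a by ring.
  by rewrite /u e1 e2 sinD sinB; ring.
apply: (@mulfI _ (2 * sin a)); first by rewrite mulf_neq0 // pnatr_eq0.
rewrite mulr0 mulr_sumr (eq_bigr (fun k : 'I_N => u k.+1 - u k)) //.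
rewrite -(big_mkord xpredT (fun k => u k.+1 - u k)) telescope_sumr //.
have -> : u N = u 0%N; last by rewrite subrr.
rewrite /u mul0rn sub0r mulrN1 -(periodicn (@sinD2pi R) r (- a)).
by congr sin; rewrite /a -[(_ *+ 2) *+ r]mulr_natr; field.
Qed.

(** The bound on m + r keeps every frequency that occurs below N, so that there is no aliasing. *)
Lemma sum_cos_walk m r : (m + r < N)%N ->
  2 ^+ m * \sum_(k < N) cos (ang k) ^+ m * cos (r%:R * ang k) = N%:R * (walk m r)%:R.
Proof.
elim: m r => [|m IH] r lt.
  rewrite mul1r; case: r lt => [|r] lt /=.
    under eq_bigr do rewrite expr0 mul1r mul0r cos0.
    by rewrite sumr_const card_ord mulr1.
  by under eq_bigr do rewrite expr0 mul1r; rewrite sum_cos ?mulr0.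
case: r lt => [|r] lt /=.
  rewrite -muln2 natrM mulrA -IH; last by lia.
  rewrite exprS; under [X in _ = _ * X * _]eq_bigr do rewrite mul1r.
  under [X in _ * _ * X = _]eq_bigr do rewrite mul0r cos0 mulr1 exprSr.
  by ring.
rewrite natrD mulrDr -!IH; [|lia|lia].
rewrite exprSr -mulrDr -!mulrA -big_split /= mulr_sumr; congr (_ * _); apply: eq_bigr => k _.
have -> : r.+2%:R * ang k = r.+1%:R * ang k + ang k by rewrite -[r.+2%:R]natr1; ring.
have -> : r%:R * ang k = r.+1%:R * ang k - ang k by rewrite -[r.+1%:R]natr1; ring.
by rewrite cosD cosB exprSr; ring.
Qed.

Definition nodesum (p : {poly R}) : R := \sum_(k < N) p.[cos (ang k)].

Lemma nodesumXodd m : odd m -> (m < N)%N -> nodesum 'X^m = 0.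
Proof.
move=> om mN; have := @sum_cos_walk m 0; rewrite addn0 walk_odd ?addn0 // mulr0 => /(_ mN) /eqP.
rewrite mulf_eq0 expf_eq0 pnatr_eq0 andbF /= => /eqP s0; rewrite -[RHS]s0.
by apply: eq_bigr => k _; rewrite hornerXn mul0r cos0 mulr1.
Qed.

Lemma nodesumXeven i : (i.*2 < N)%N ->
  4 ^+ i * nodesum 'X^(i.*2) = N%:R * 'C(i.*2, i)%:R.
Proof.
move=> iN; rewrite -(@walk_bin _ 0 i) // -sum_cos_walk ?addn0 //.
have -> : 4 ^+ i = 2 ^+ i.*2 :> R by rewrite -mul2n exprM -[2 ^+ 2]natrX.
congr (_ * _); apply: eq_bigr => k _.
by rewrite hornerXn mul0r cos0 mulr1.
Qed.

Lemma nodesumD p q : nodesum (p + q) = nodesum p + nodesum q.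
Proof. by rewrite -big_split; apply: eq_bigr => k _; rewrite hornerD. Qed.
Lemma nodesumZ a p : nodesum (a *: p) = a * nodesum p.
Proof. by rewrite mulr_sumr; apply: eq_bigr => k _; rewrite hornerZ. Qed.
Lemma nodesumB p q : nodesum (p - q) = nodesum p - nodesum q.
Proof. by rewrite -scaleN1r nodesumD nodesumZ mulN1r. Qed.

(** At cos t this is sin^(2j) t. *)
Definition wpoly j : {poly R} := (1 - 'X^2) ^+ j.

Lemma nodesum_odd j m : odd m -> (m + j.*2 < N)%N -> nodesum ('X^m * wpoly j) = 0.
Proof.
elim: j m => [|j IH] m om lt; first by rewrite /wpoly expr0 mulr1 nodesumXodd //; lia.
have -> : 'X^m * wpoly j.+1 = 'X^m * wpoly j - 'X^(m.+2) * wpoly j.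
  by rewrite /wpoly (exprS _ j) -(addn2 m) exprD; ring.
by rewrite nodesumB !IH ?subrr //=; lia.
Qed.

(** Gamma(j + 1/2) / Gamma(1/2), the part of the Beta integral below that depends on j alone. *)
Definition wconst j : R := \prod_(t < j) (t%:R + 2^-1).

Lemma wconst_gt0 j : 0 < wconst j.
Proof. by apply: prodr_gt0 => t _; rewrite ltr_wpDl ?invr_gt0. Qed.

(** The Beta integral for the mean of cos^(2i) t sin^(2j) t. The factors 4^i and (2i)! are those of
    a Taylor expansion with step 2 sqrt(Q) cos t, so that exactly the Bessel coefficient remains. *)
Lemma nodesum_even j i : (i.*2 + j.*2 < N)%N ->
  4 ^+ i * nodesum ('X^(i.*2) * wpoly j) =
  N%:R * wconst j * (i.*2)`!%:R * kercoef R j.+1 i.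
Proof.
elim: j i => [|j IH] i lt.
  rewrite /wpoly expr0 mulr1 nodesumXeven; last by lia.
  rewrite /wconst big_ord0 mulr1 /kercoef addn0 -mulrA; congr (_ * _).
  have le : (i <= i.*2)%N by lia.
  have -> : (i.*2)`! = ('C(i.*2, i) * (i`! * i`!))%N.
    by rewrite -(bin_fact le); congr (_ * (_ * _`!))%N; lia.
  by rewrite natrM mulfK // pnatr_eq0 -lt0n muln_gt0 fact_gt0.
have -> : 'X^(i.*2) * wpoly j.+1 = 'X^(i.*2) * wpoly j - 'X^(i.+1.*2) * wpoly j.
  by rewrite /wpoly (exprS _ j) doubleS -(addn2 i.*2) exprD; ring.
rewrite nodesumB mulrBr IH; last by lia.
have -> : 4 ^+ i * nodesum ('X^(i.+1.*2) * wpoly j) =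
    4^-1 * (N%:R * wconst j * (i.+1.*2)`!%:R * kercoef R j.+1 i.+1).
  by rewrite -IH ?exprS ?[RHS]mulrA ?mulKf //; lia.
rewrite doubleS !factS !natrM /wconst big_ord_recr /= -/(wconst j).
have k0 : kercoef R j.+1 i = (i + j.+1)%:R * kercoef R j.+2 i by rewrite kercoefD.
have k1 : kercoef R j.+1 i.+1 = kercoef R j.+2 i / i.+1%:R.
  by rewrite -(@kercoefS _ j.+1 i) // mulrC mulKf // pnatr_eq0.
rewrite k0 k1 -muln2 -[(i * 2).+2%:R]natr1 -[(i * 2).+1%:R]natr1 natrM -[i.+1%:R]natr1 natrD -[j.+1%:R]natr1.
have : i%:R + 1 != 0 :> R by rewrite natr1 pnatr_eq0.
move: (i%:R) => I I0; field.
by rewrite ?[1 + _]addrC.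
Qed.
End RootsOfUnity.

Lemma sum_even_odd (V : nmodType) (f : nat -> V) n :
  \sum_(l < n.*2) f l = \sum_(i < n) (f i.*2 + f i.*2.+1).
Proof.
elim: n => [|n IH]; first by rewrite !big_ord0.
by rewrite doubleS !big_ord_recr IH /= addrA.
Qed.

(** * Positivity of the kernels and of the multiplier *)

Section KernelPositivity.
Variable R : realType.
Implicit Types (p G F g : {poly R}) (x y : R).

(** Taylor expansion of [G] at A: odd powers of the cosine cancel, and even ones reproduce the terms
    of the kernel. The lower bound on N exceeds every degree that occurs, so the node sums are
    exact. *)
Lemma kern_nodesum j G x y N : ((size G).*2 + j.*2 <= N)%N ->
  0 <= kerQ x y ->
  N%:R * wconst R j * kern idfun j.+1 G x y =
  \sum_(k < N) (wpoly R j).[cos (ang R N k)] *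
     G.[kerA x y + Num.sqrt (4 * kerQ x y) * cos (ang R N k)].
Proof.
have ltN a b c n : (b.*2 + c.*2 <= n -> a < b -> a.*2.+1 + c.*2 < n)%N by lia.
move=> leN Q0; set A := kerA x y; set Q := kerQ x y; set h := Num.sqrt _.
have hh : h ^+ 2 = 4 * Q by rewrite sqr_sqrtr // mulr_ge0.
have taylor (s : R) : G.[A + h * s] = \sum_(l < (size G).*2) G^`N(l).[A] * (h * s) ^+ l.
  by apply: nderiv_taylor_wide; [exact: mulrC|rewrite -addnn leq_addr].
transitivity (\sum_(l < (size G).*2) G^`N(l).[A] * h ^+ l * nodesum N ('X^l * wpoly R j)).
  rewrite (sum_even_odd (fun l => G^`N(l).[A] * h ^+ l * nodesum N ('X^l * wpoly R j))).
  rewrite mulr_sumr; apply: eq_bigr => i _; have iG := ltn_ord i.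
  have -> : nodesum N ('X^(i.*2.+1) * wpoly R j) = 0.
    by apply: nodesum_odd; [rewrite /= odd_double|exact: (ltN _ _ _ _ leN iG)].
  rewrite mulr0 addr0.
  have -> : h ^+ i.*2 = 4 ^+ i * Q ^+ i by rewrite -mul2n exprM hh exprMn.
  rewrite (_ : _ * _ * nodesum N _ = G^`N(i.*2).[A] * Q ^+ i * (4 ^+ i * nodesum N ('X^(i.*2) * wpoly R j))); last by ring.
  rewrite nodesum_even; last exact: ltnW (ltN _ _ _ _ leN iG).
  rewrite /ev map_poly_id // nderivn_def hornerMn -/A -/Q.
  by rewrite /=; ring.
under eq_bigr do rewrite /nodesum mulr_sumr.
rewrite exchange_big; apply: eq_bigr => k _ /=.
rewrite taylor mulr_sumr; apply: eq_bigr => l _.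
by rewrite hornerM hornerXn exprMn; ring.
Qed.

Definition nonneg01 (p : {poly R}) := forall x, 0 <= x <= 1 -> 0 <= p.[x].

Lemma kern_ge0 j G x y : nonneg01 G -> (0 < j)%N -> 0 <= x <= 1 -> 0 <= y <= 1 ->
  0 <= kern idfun j G x y.
Proof.
case: j => // j G0 _ x01 y01.
have Q0 : 0 <= kerQ x y by rewrite /kerQ !mulr_ge0 //; lra.
set N := ((size G).*2 + j.*2).+1.
have := @kern_nodesum j G x y N (leqnSn _) Q0.
set s := \sum_(_ < _) _ => eK.
suff : 0 <= s.
  by rewrite -eK pmulr_rge0 // mulr_gt0 ?wconst_gt0 // ltr0n.
apply: sumr_ge0 => k _; set c := cos _.
have [c1 c2] : -1 <= c /\ c <= 1 by rewrite cos_geN1 cos_le1.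
have c2' : 0 <= 1 - c ^+ 2 by nra.
apply: mulr_ge0; first by rewrite /wpoly horner_exp exprn_ge0 // !hornerE.
apply: G0.
have Q40 : 0 <= 4 * kerQ x y by rewrite mulr_ge0.
set h := Num.sqrt _; have h0 : 0 <= h by exact: sqrtr_ge0.
have hh : h ^+ 2 = 4 * kerQ x y by rewrite sqr_sqrtr.
have A0 : 0 <= kerA x y by rewrite /kerA addr_ge0 // mulr_ge0 //; lra.
have A1 : 0 <= 1 - kerA x y.
  have -> : 1 - kerA x y = x * (1 - y) + y * (1 - x) by rewrite /kerA; ring.
  by rewrite addr_ge0 // mulr_ge0 //; lra.
(* A is the sum of xy and (1-x)(1-y), and 1-A is the sum of x(1-y) and y(1-x). Both pairs have
   product Q, so 2 sqrt(Q) is below A and below 1-A, and the argument of [G] stays in [0,1]. *)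
have hA : h <= kerA x y.
  rewrite -ler_sqr ?nnegrE // hh /kerA /kerQ -subr_ge0.
  by rewrite [X in 0 <= X](_ : _ = (x * y - (1 - x) * (1 - y)) ^+ 2) ?sqr_ge0 //; ring.
have hA1 : h <= 1 - kerA x y.
  rewrite -ler_sqr ?nnegrE // hh /kerA /kerQ -subr_ge0.
  by rewrite [X in 0 <= X](_ : _ = (x * (1 - y) - (1 - x) * y) ^+ 2) ?sqr_ge0 //; ring.
by apply/andP; split; nra.
Qed.

Lemma poly_ndecr p a b : a <= b ->
  (forall x, a <= x <= b -> 0 <= p^`().[x]) -> p.[a] <= p.[b].
Proof.
move=> ab dp.
apply: (@ger0_derive1_ndecr _ (horner p) a b) => //; try exact: lexx.
- move=> x; rewrite in_itv /= => /andP[ax xb].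
  by rewrite -derivE dp // !ltW.
- by apply: continuous_subspaceT => x; exact: continuous_horner.
Qed.

Lemma integ_ge0 p : nonneg01 p -> 0 <= integ p.
Proof.
move=> p0; rewrite -prim_1 -(prim_0 p).
by apply: poly_ndecr => // x x01; rewrite deriv_prim p0.
Qed.

Lemma Kop_horner j F g x : (Kop j F g).[x] =
  integ (kern polyC j F x%:P 'X * g * ('X * (1 - 'X)) ^+ j.-1).
Proof.
rewrite /Kop -/(horner_eval x _) integ_map; last exact: natr_poly_unit.
rewrite !rmorphM rmorphXn /= map_horner_inY rmorphM rmorphB rmorph1 /=.
rewrite (@kern_map _ _ _ _ _ polyC); last first.
  by move=> a; rewrite /= map_polyC /= /horner_eval hornerC.
by rewrite /= /vX /vY map_polyC map_polyX /= /horner_eval hornerX.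
Qed.

Lemma kern_horner_ge0 j F x : nonneg01 F -> (0 < j)%N -> 0 <= x <= 1 ->
  nonneg01 (kern polyC j F x%:P 'X).
Proof.
move=> F0 j0 x01 y y01; rewrite -/(horner_eval y _) (@kern_map _ _ _ _ _ idfun).
  by rewrite /= /horner_eval hornerC hornerX kern_ge0.
by move=> a; rewrite /= /horner_eval hornerC.
Qed.

Lemma Kop_ge0 j F g : (0 < j)%N -> nonneg01 F -> nonneg01 g -> nonneg01 (Kop j F g).
Proof.
move=> j0 F0 g0 x x01; rewrite Kop_horner; apply: integ_ge0 => y y01.
rewrite !hornerM !mulr_ge0 ?kern_horner_ge0 ?g0 //.
rewrite horner_exp !hornerE exprn_ge0 //; nra.
Qed.

Lemma Op_ge0 F p : integ F = 1 -> nonneg01 F -> nonneg01 F^`() -> nonneg01 p ->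
  nonneg01 (Op F p).
Proof.
move=> F1 F0 dF0 p0 x x01.
have P0 (z : R) : 0 <= z <= 1 -> 0 <= (prim F).[z].
  move=> z01; rewrite -[X in X <= _](prim_0 F); apply: poly_ndecr; first by lra.
  by move=> t t01; rewrite deriv_prim F0 //; lra.
rewrite /Op !hornerD !hornerZ horner_comp !hornerM hornerD hornerN hornerX hornerC.
rewrite !addr_ge0 ?mulr_ge0 ?P0 ?p0 //; try lra.
rewrite -/(horner_eval x _) integ_map; last exact: natr_poly_unit.
rewrite rmorphM /= map_horner_inY (@kern_map _ _ _ _ _ polyC); last first.
  by move=> a; rewrite /= map_polyC /= /horner_eval hornerC.
rewrite /= /vX /vY map_polyC map_polyX /= /horner_eval hornerX.
apply: integ_ge0 => y y01.
by rewrite hornerM mulr_ge0 ?kern_horner_ge0 ?p0.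
Qed.
End KernelPositivity.

(** * Alternating binomial sums of polynomials and simple fractions *)

Section AlternatingSums.
Variable R : numFieldType.
Implicit Types (p : {poly R}) (y z : R).

(** The m-th forward difference at 0, up to the sign (-1)^m; hence it annihilates polynomials of
    degree below m. *)
Definition altsum m (f : nat -> R) : R := \sum_(i < m.+1) (-1) ^+ i * 'C(m, i)%:R * f i.

Lemma altsumS m f : altsum m.+1 f = altsum m f - altsum m (fun i => f i.+1).
Proof.
have -> : altsum m f = \sum_(i < m.+2) (-1) ^+ i * 'C(m, i)%:R * f i.
  by rewrite [RHS]big_ord_recr /= bin_small // mulr0 mul0r addr0.
rewrite /altsum big_ord_recl [X in _ = X - _]big_ord_recl /= !bin0 -addrA -sumrB.
congr (_ + _); apply: eq_bigr => i _.
by rewrite /bump /= add1n binS natrD exprS; ring.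
Qed.

Lemma eq_altsum m f h : (forall i, (i <= m)%N -> f i = h i) -> altsum m f = altsum m h.
Proof. by move=> e; apply: eq_bigr => i _; rewrite e // -ltnS. Qed.

Lemma altsumD m f h : altsum m (fun i => f i + h i) = altsum m f + altsum m h.
Proof. by rewrite -big_split; apply: eq_bigr => i _; rewrite mulrDr. Qed.

Lemma altsumZ m a f : altsum m (fun i => a * f i) = a * altsum m f.
Proof. by rewrite mulr_sumr; apply: eq_bigr => i _; rewrite mulrCA. Qed.

Lemma size_shift_sub p m : (size p <= m.+1)%N -> (size (p - (p \Po ('X + 1%:P)))%R <= m)%N.
Proof.
move=> sz; apply/leq_sizeP => j; rewrite leq_eqVlt => /predU1P [<-|lt].
  have sz' : (size (p \Po ('X + 1%:P))%R <= m.+1)%N by rewrite size_comp_poly2 // size_XaddC.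
  rewrite coefB; move: sz; rewrite leq_eqVlt => /predU1P [sz|lt]; last first.
    by rewrite !nth_default ?subrr // size_comp_poly2 ?size_XaddC.
  have : lead_coef (p \Po ('X + 1%:P)) = lead_coef p.
    by rewrite lead_coef_comp ?size_XaddC // lead_coefXaddC expr1n mulr1.
  by rewrite /lead_coef size_comp_poly2 ?size_XaddC // sz /= => ->; rewrite subrr.
by rewrite coefB !nth_default ?subrr // ?size_comp_poly2 ?size_XaddC // (leq_trans sz).
Qed.

Lemma altsum_poly m p : (size p <= m)%N -> altsum m (fun i => p.[i%:R]) = 0.
Proof.
elim: m p => [|m IH] p sz.
  move: sz; rewrite leqn0 size_poly_eq0 => /eqP ->.
  by rewrite /altsum big1 // => i _; rewrite horner0 mulr0.
rewrite altsumS -[RHS](IH _ (size_shift_sub sz)).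
have -> : forall u v : R, u - v = u + -1 * v by move=> *; ring.
rewrite -altsumZ -altsumD; apply: eq_altsum => i _.
by rewrite hornerD hornerN horner_comp hornerD hornerX hornerC natr1 mulN1r.
Qed.

(** The Pochhammer symbol (z)_m. *)
Definition rise z m : R := \prod_(l < m) (z + l%:R).

Lemma riseS z m : rise z m.+1 = rise z m * (z + m%:R).
Proof. by rewrite /rise big_ord_recr. Qed.

Lemma riseSl z m : rise z m.+1 = z * rise (z + 1) m.
Proof.
rewrite /rise big_ord_recl /= addr0; congr (_ * _); apply: eq_bigr => i _.
by rewrite /bump /= natrD addrA.
Qed.

Lemma rise_gt0 z m : 0 < z -> 0 < rise z m.
Proof. by move=> z0; apply: prodr_gt0 => i _; rewrite ltr_wpDr. Qed.

Lemma altsum_inv m y : 0 < y -> altsum m (fun i => (i%:R + y)^-1) = m`!%:R / rise y m.+1.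
Proof.
elim: m y => [|m IH] y y0.
  by rewrite /altsum /rise !big_ord1 /= bin0 addr0 add0r expr0 !mul1r.
rewrite altsumS IH //.
have -> : altsum m (fun i => (i.+1%:R + y)^-1) = altsum m (fun i => (i%:R + (y + 1))^-1).
  by apply: eq_altsum => i _; rewrite -natr1 -addrA (addrC 1).
rewrite IH ?addr_gt0 // factS natrM (riseSl y m).
have r0 : rise (y + 1) m != 0 by rewrite gt_eqF // rise_gt0 // addr_gt0.
have y1 : y + 1 + m%:R != 0 by rewrite gt_eqF // ltr_wpDr // addr_gt0.
rewrite (riseSl y m.+1) !(riseS (y + 1) m) -[m.+1%:R]natr1; field.
by rewrite r0 y1 gt_eqF.
Qed.

(** Division of [p] by X + y: the quotient has degree below m and is annihilated, and the remainder
    p(-y) multiplies the pure fraction of [altsum_inv]. *)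
Lemma altsum_div m p y : (size p <= m.+1)%N -> 0 < y ->
  altsum m (fun i => p.[i%:R] / (i%:R + y)) = p.[- y] * m`!%:R / rise y m.+1.
Proof.
move=> sz y0.
have /factor_theorem [q qE] : root (p - p.[-y]%:P) (- y).
  by rewrite /root hornerD hornerN hornerC subrr.
have szq : (size q <= m)%N.
  have [->|q0] := eqVneq q 0; first by rewrite size_poly0.
  have : (size (p - p.[-y]%:P)%R <= m.+1)%N.
    by rewrite (leq_trans (size_polyD _ _)) // geq_max sz size_polyN (leq_trans (size_polyC_leq1 _)).
  by rewrite qE size_Mmonic ?monicXsubC // size_XsubC addn2.
rewrite (@eq_altsum _ _ (fun i => q.[i%:R] + p.[- y] * (i%:R + y)^-1)).
  by rewrite altsumD altsumZ altsum_poly // add0r altsum_inv // mulrA.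
move=> i _; have iy : i%:R + y != 0 by rewrite gt_eqF // ltr_wpDl.
have -> : p.[i%:R] = q.[i%:R] * (i%:R + y) + p.[- y].
  have := congr1 (horner ^~ i%:R) qE.
  by rewrite /= hornerM !hornerD !hornerN hornerX !hornerC opprK => <-; rewrite subrK.
by rewrite mulrDl mulfK.
Qed.
End AlternatingSums.

(** * Jacobi polynomials and the moments of their squares *)

Section Jacobi.
Variables (R : realType) (a m : nat).

(* Rodrigues: X^a * jpoly is the m-th derivative of X^(m+a) (1-X)^m. *)
Definition jpoly : {poly R} :=
  \poly_(i < m.+1) ((-1) ^+ i * 'C(m, i)%:R * rise (a + 1 + i)%:R m).

(** The coefficients of [jpoly] are values at i of one polynomial of degree m, up to signed
    binomials, so [altsum_div] applies. The factor (a-s)_m vanishes for a <= s < a+m: this is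
    orthogonality for the weight X^a. *)
Lemma integ_jpolyX s : integ (jpoly * 'X^s) =
  rise (a%:R - s%:R) m * m`!%:R / rise s.+1%:R m.+1.
Proof.
pose N : {poly R} := \prod_(l < m) ('X + (a + 1 + l)%:R%:P).
have NE z : N.[z] = rise (z + (a + 1)%:R) m.
  rewrite horner_prod; apply: eq_bigr => l _.
  by rewrite hornerD hornerX hornerC natrD addrA.
have szN : (size N <= m.+1)%N.
  rewrite /N (leq_trans (size_prod_leq _ _)) // (eq_bigr (fun=> 2%N)); last by move=> l _; rewrite size_XaddC.
  by rewrite sum_nat_const card_ord; lia.
have := @altsum_div _ m N s.+1%:R szN (ltr0Sn _ _).
rewrite NE [- _ + _](_ : _ = a%:R - s%:R); last by rewrite natrD -natr1; ring.
move=> <-; rewrite (@integ_widen _ (m.+1 + s)%N); last first.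
  rewrite (leq_trans (size_polyMleq _ _)) // size_polyXn addnS /= leq_add2r size_poly //.
rewrite addnC big_split_ord /= big1 ?add0r => [|i _]; last by rewrite coefMXn ltn_ord mul0r.
apply: eq_bigr => i _; rewrite coefMXn ltnNge leq_addr /= addKn coef_poly ltn_ord NE.
by rewrite -!natrD -!mulrA; congr (_ * (_ * (rise _%:R _ / _%:R))); lia.
Qed.
End Jacobi.

Section Jacobi.
Variables (R : realType).
Local Notation jpoly := (jpoly R).

Lemma integ_sum I (s : seq I) (P : pred I) (F : I -> {poly R}) :
  integ (\sum_(i <- s | P i) F i) = \sum_(i <- s | P i) integ (F i).
Proof. exact: (big_morph (@integ R) (@integD R) (integ0 R)). Qed.

Lemma rise0 m i : (i < m)%N -> rise (- i%:R : R) m = 0.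
Proof. by move=> im; rewrite /rise (bigD1 (Ordinal im)) //= addNr mul0r. Qed.

(** One factor is expanded in monomials. By orthogonality the powers of index k <= i <= m integrate
    to zero against the other factor, and k explicit terms remain. *)
Lemma integ_jpoly_sqr a m k : (0 < k)%N -> (k <= m.+1)%N -> (k <= a)%N ->
  integ (jpoly a m ^+ 2 * 'X^(a - k)) =
  \sum_(i < k) ((-1) ^+ i * 'C(m, i)%:R * rise (a + 1 + i)%:R m) *
    (rise (k%:R - i%:R) m * m`!%:R / rise (a - k + i).+1%:R m.+1).
Proof.
move=> k0 km ka.
have -> : jpoly a m ^+ 2 * 'X^(a - k) = \sum_(i < m.+1)
    ((-1) ^+ i * 'C(m, i)%:R * rise (a + 1 + i)%:R m)%:P * (jpoly a m * 'X^(a - k + i)).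
  rewrite expr2 -mulrA {1}/jpoly poly_def mulr_suml; apply: eq_bigr => i _.
  by rewrite -mul_polyC exprD; ring.
rewrite integ_sum; under eq_bigr do rewrite integZ integ_jpolyX.
have e i : a%:R - (a - k + i)%:R = k%:R - i%:R :> R by rewrite natrD natrB //; ring.
under eq_bigr do rewrite e.
rewrite (@big_ord_widen _ _ _ k m.+1 (fun i => ((-1) ^+ i * 'C(m, i)%:R * rise (a + 1 + i)%:R m) *
    (rise (k%:R - i%:R) m * m`!%:R / rise (a - k + i).+1%:R m.+1))); last by lia.
rewrite [RHS]big_mkcond; apply: eq_bigr => i _; case: ltnP => // ki.
have -> : k%:R - i%:R = - (i - k)%:R :> R by rewrite natrB //; ring.
by rewrite rise0 ?mul0r ?mulr0 //; have := ltn_ord i; lia.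
Qed.

Lemma rise1 m : rise (1 : R) m = m`!%:R.
Proof.
elim: m => [|m IH]; first by rewrite /rise big_ord0.
by rewrite riseS IH factS natrM nat1r mulrC.
Qed.

(** With M = m+2, x is M(M+a+1), the eigenvalue of the Jacobi differential equation up to sign. The
    two moments share a factor and are otherwise of degree 1 and 2 in x, so their quotient is
    O(1/x); this is the origin of the order n^-2. *)
Lemma jpoly_moments r m (x := (m%:R + 2) * (m%:R + 2 + r%:R + 4) : R) (a := r%:R + 3 : R) :
  exists2 K : R, 0 < K &
  integ (jpoly r.+3 m.+2 ^+ 2 * 'X^(r.+1)) = K * (2 * x + a * (a + 1)) * (2 * (a - 2) * (a + 2)) /\
  integ (jpoly r.+3 m.+2 ^+ 2 * 'X^r) = K * (12 * x ^+ 2 + (8 * a ^+ 2 + 12 * a - 8) * x + 2 * a * (a - 1) * (a + 1) * (a + 2)).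
Proof.
have a2 : 0 < a - 2 by rewrite /a addrAC -addrA; apply: ltr_wpDl => //; lra.
set M := m.+2; set f : R := M`!%:R.
have f0 : 0 < f by rewrite ltr0n fact_gt0.
set rho := rise (a + 1) M; have rho0 : 0 < rho by rewrite rise_gt0 //; lra.
set mu : R := M%:R; have mu0 : 0 < mu by rewrite ltr0n.
have muE : mu = m%:R + 2 by rewrite /mu /M -!natr1; ring.
have xE : x = mu * (mu + a + 1) by rewrite /x muE /a; ring.
have shift z : z != 0 -> rise (z + 1) M = rise z M * (z + mu) / z.
  by move=> z0; rewrite -riseS riseSl mulrAC mulfV ?mul1r.
have R1 : rise 1 M = f by rewrite rise1.
have R2 : rise 2 M = f * (1 + mu) by rewrite (_ : 2 = 1 + 1) // shift // R1 divr1.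
have R3 : rise 3 M = f * (1 + mu) * (2 + mu) / 2.
  have -> : 3 = 2 + 1 :> R by ring.
  by rewrite shift ?pnatr_eq0 // R2.
have A1 : rise (a + 1 + 1) M = rho * (a + 1 + mu) / (a + 1) by rewrite shift //; lra.
have A2 : rise (a + 1 + 1 + 1) M = rho * (a + 1 + mu) / (a + 1) * (a + 1 + 1 + mu) / (a + 1 + 1).
  by rewrite shift ?A1 //; lra.
have D1 : rise a M.+1 = a * rho by rewrite riseSl.
have rhoE : rho = rise (a - 1) M * (a - 1 + mu) / (a - 1) * (a + mu) / a.
  rewrite /rho shift; last by lra.
  have {1}-> : a = a - 1 + 1 by ring.
  by rewrite shift //; lra.
have D2 : rise (a - 1) M.+1 = (a - 1) * a * rho / (a + mu).
  rewrite riseS rhoE; field; rewrite !gt_eqF //; lra.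
have D3 : rise (a - 1 - 1) M.+1 = (a - 2) * (a - 1) * a * rho / ((a + mu) * (a + mu - 1)).
  have := shift (a - 1 - 1); rewrite subrK => sh.
  rewrite riseS rhoE sh; last by lra.
  by field; rewrite !gt_eqF //; lra.
(* The factor common to the two closed forms; later only its positivity matters. *)
exists (f ^+ 2 / (2 * (a - 2) * (a - 1) * a * (a + 1) * (a + 2))).
  by rewrite divr_gt0 ?exprn_gt0 // !mulr_gt0 //; lra.
have bin2 : 'C(M, 2)%:R = mu * (mu - 1) / 2 :> R.
  have := congr1 (fun n => n%:R : R) (bin_ffact M 2).
  rewrite /= ffactnS ffactn1 !natrM /M /= -/M -/mu => e.
  have -> : mu - 1 = m.+1%:R by rewrite /mu /M -natr1; ring.
  by rewrite -e mulfK.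
have aE1 : r.+4%:R = a + 1 :> R by rewrite /a -!natr1; ring.
have aE2 : r.+1.+4%:R = a + 1 + 1 :> R by rewrite /a -!natr1; ring.
have aE3 : r.+2.+4%:R = a + 1 + 1 + 1 :> R by rewrite /a -!natr1; ring.
have bE0 : (r.+1)%:R = a - 1 - 1 :> R by rewrite /a -!natr1; ring.
have bE1 : (r.+2)%:R = a - 1 :> R by rewrite /a -!natr1; ring.
have bE2 : (r.+3)%:R = a :> R by rewrite /a -!natr1; ring.
split.
- have := @integ_jpoly_sqr r.+3 M 2 isT isT isT; rewrite !subSS subn0 => ->.
  rewrite !big_ord_recl big_ord0 /= /bump /= ?addn0 expr0 expr1 bin0 bin1.
  rewrite ?addn1 ?addn0.
  rewrite aE1 aE2 bE1 bE2 D1 D2 -/f -/mu.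
  have -> : 2 - 0 = 2 :> R by ring.
  have -> : 2 - 1 = 1 :> R by ring.
  rewrite R1 R2.
  rewrite A1 xE -/rho; field; rewrite !gt_eqF //; lra.
- have := @integ_jpoly_sqr r.+3 M 3 isT isT isT; rewrite !subSS subn0 => ->.
  rewrite !big_ord_recl big_ord0 /= /bump /= ?addn0 expr0 expr1 bin0 bin1.
  rewrite ?addn1 ?addn2 ?addn0.
  rewrite aE1 aE2 aE3 bE0 bE1 bE2 D1 D2 D3 bin2 -/f -/mu.
  have -> : 3 - 0 = 3 :> R by ring.
  have -> : 3 - 1 = 2 :> R by ring.
  have -> : 3 - 2 = 1 :> R by ring.
  rewrite R1 R2 R3.
  rewrite A1 A2 xE -/rho; field; rewrite !gt_eqF //; lra.
Qed.
End Jacobi.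

(** * The profile polynomial *)

Section Profile.
Variable R : realType.
Implicit Types (p : {poly R}).

Lemma prim_ge0 p : nonneg01 p -> nonneg01 (prim p).
Proof.
move=> p0 x x01; rewrite -[X in X <= _](prim_0 p); apply: poly_ndecr; first by lra.
by move=> t t01; rewrite deriv_prim p0 //; lra.
Qed.

Lemma iter_prim_ge0 n p : nonneg01 p -> nonneg01 (iter n (@prim R) p).
Proof. by move=> p0; elim: n => //= n IH; exact: prim_ge0. Qed.

Lemma derivn_iter_prim n i p : (i <= n)%N ->
  (iter n (@prim R) p)^`(i) = iter (n - i) (@prim R) p.
Proof.
elim: n i => [|n IH] [|i] //= le; rewrite -derivnS ?derivSn ?deriv_prim; exact: IH.
Qed.

Lemma size_iter_prim n p : (size (iter n (@prim R) p) <= size p + n)%N.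
Proof.
elim: n => [|n IH]; first by rewrite addn0.
by rewrite /= addnS (leq_trans (size_poly _ _)).
Qed.

Lemma integ_prim n p :
  integ ((1 - 'X) ^+ n.+1 * p) = n.+1%:R * integ ((1 - 'X) ^+ n * prim p).
Proof.
have d1X : (1 - 'X : {poly R})^`() = -1 by rewrite derivB derivX -[1]/(1%:P) derivC sub0r.
have e : ((1 - 'X) ^+ n.+1 * prim p)^`() =
    (1 - 'X) ^+ n.+1 * p - n.+1%:R%:P * ((1 - 'X) ^+ n * prim p).
  by rewrite derivM deriv_prim deriv_exp /= d1X -[_ *+ n.+1]mulr_natr polyC_natr; ring.
have := congr1 (@integ R) e; rewrite integ_deriv; last exact: natr_unit.
rewrite !hornerM prim_0 mulr0 subr0 horner_exp hornerD hornerN hornerX hornerC.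
rewrite subrr expr0n mul0r integD integN.
have -> := integZ n.+1%:R ((1 - 'X) ^+ n * prim p).
by move=> /eqP; rewrite eq_sym subr_eq0 => /eqP.
Qed.

(** Cauchy's formula for repeated integration. *)
Lemma integ_iter_prim n p :
  integ (iter n (@prim R) p) = integ ((1 - 'X) ^+ n * p) / n`!%:R.
Proof.
elim: n p => [|n IH] p; first by rewrite expr0 mul1r divr1.
by rewrite iterSr IH integ_prim factS natrM -mulf_div divff ?mul1r // pnatr_eq0.
Qed.

(** Since x >= 1, the constant A is absorbed into a multiple of x; s, later (m+2)^2, is at most x
    and supplies the second factor x. *)
Lemma moment_ratio (K x A D s : R) : 0 <= K -> 0 <= A -> 0 <= D -> 1 <= x ->
  0 <= s -> s <= x -> K * (2 * x + A) * D * s <= (2 + A) * D * (K * (12 * x ^+ 2)).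
Proof.
move=> K0 A0 D0 x1 s0 sx.
have e1 : (2 * x + A) * s <= (2 + A) * x * x.
  have h : 0 <= A * (x - 1) by rewrite mulr_ge0 // subr_ge0.
  by apply: ler_pM => //; lra.
have KD : 0 <= K * D by rewrite mulr_ge0.
have -> : K * (2 * x + A) * D * s = K * D * ((2 * x + A) * s) by ring.
have -> : (2 + A) * D * (K * (12 * x ^+ 2)) = K * D * (12 * ((2 + A) * x * x)) by ring.
apply: ler_wpM2l => //; apply: (le_trans e1).
by rewrite ler_peMl ?ler1n // !mulr_ge0 //; lra.
Qed.

(* The [r]-fold primitive of a squared Jacobi polynomial, which concentrates
   near [1] at scale [m^-2], has all derivatives up to order [r] nonnegative. *)
Lemma profile_exists (r : nat) : exists2 C : R, 0 <= C & forall m : nat,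
  exists F : {poly R}, [/\ (size F <= m.*2 + 5 + r)%N, integ F = 1,
    forall i, (i <= r)%N -> nonneg01 F^`(i) &
    integ (F * (1 - 'X)) * (m.+2%:R) ^+ 2 <= C].
Proof.
pose a : R := r%:R + 3.
(* The factor (2 + A) D of [moment_ratio] for A = a(a+1) and D = 2(a-2)(a+2). *)
exists ((2 + a * (a + 1)) * (2 * (a - 2) * (a + 2))).
  have a3 : 3 <= a by rewrite /a lerDr.
  have aa : 0 <= a * (a + 1) by rewrite mulr_ge0; lra.
  by rewrite !mulr_ge0 //; lra.
move=> m; have [K K0 [I2 I3]] := @jpoly_moments R r m.
have r0 := ler0n R r; have m0 := ler0n R m.
set x := (m%:R + 2) * _ in I2 I3; rewrite -/a in I2 I3.
have xm : m.+2%:R ^+ 2 <= x by rewrite -!natr1 /x; nra.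
have x1 : 1 <= x by rewrite (le_trans _ xm) // -!natr1; nra.
have a3 : 3 <= a by rewrite /a; lra.
set J := jpoly R r.+3 m.+2 ^+ 2 in I2 I3.
set Jh := J \Po (1 - 'X).
have Jh0 : nonneg01 Jh by move=> t _; rewrite /Jh /J horner_comp horner_exp sqr_ge0.
have flip n : (1 - 'X) ^+ n * Jh = (J * 'X^n) \Po (1 - 'X).
  by rewrite comp_polyM comp_Xn_poly mulrC.
set F0 := iter r (@prim R) Jh.
set c := integ F0.
have cE : c = integ (J * 'X^r) / r`!%:R.
  by rewrite /c integ_iter_prim flip integ_flip.
have fact0 n : 0 < n`!%:R :> R by rewrite ltr0n fact_gt0.
have I30 : 0 < integ (J * 'X^r).
  rewrite I3 mulr_gt0 //.
  have -> : 8 * a ^+ 2 + 12 * a - 8 = 8 * (a * (a + 1)) + 4 * (a - 2) by ring.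
  have aa : 0 < a * (a + 1) by rewrite mulr_gt0; lra.
  have xx : 0 < x ^+ 2 by rewrite exprn_gt0; lra.
  have h1 : 0 < (8 * (a * (a + 1)) + 4 * (a - 2)) * x by rewrite mulr_gt0; lra.
  have h2 : 0 < 2 * a * (a - 1) * (a + 1) * (a + 2) by rewrite !mulr_gt0; lra.
  lra.
have c0 : 0 < c by rewrite cE divr_gt0.
(* By parts, the first moment of [F0] at the point 1 is the integral of one more primitive. So it
   leads to the power r+1 of X against [J], where the mass [c] led to the power r. *)
have I2c : integ ((1 - 'X) * F0) = integ (J * 'X^(r.+1)) / r.+1`!%:R.
  have := integ_prim 0 F0; rewrite expr1 expr0 !mul1r => ->.
  by rewrite -[prim F0]/(iter r.+1 (@prim R) Jh) integ_iter_prim flip integ_flip.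
exists (c^-1 *: F0); split.
- rewrite (leq_trans (size_scale_leq _ _)) // (leq_trans (size_iter_prim _ _)) //.
  rewrite leq_add2r /Jh size_comp_poly2; last by rewrite -opprB size_polyN -[1]/(1%:P) size_XsubC.
  have szg : (size (jpoly R r.+3 m.+2) <= m.+3)%N by exact: size_poly.
  have arith k : (k <= m.+3 -> (k + k).-1 <= m.*2 + 5)%N by lia.
  by rewrite /J expr2 (leq_trans (size_polyMleq _ _)) // arith.
- by rewrite -mul_polyC integZ mulVf // gt_eqF.
- move=> i ir t t01; rewrite derivnZ hornerZ; apply: mulr_ge0; first by rewrite invr_ge0 ltW.
  rewrite /F0 derivn_iter_prim //; exact: (iter_prim_ge0 _ Jh0).
have -> : c^-1 *: F0 * (1 - 'X) = c^-1%:P * ((1 - 'X) * F0).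
  by rewrite -mul_polyC; ring.
rewrite integZ I2c cE factS natrM.
set D := 2 * (a - 2) * (a + 2).
have D0 : 0 <= D by rewrite /D !mulr_ge0 //; lra.
have K3 : K * (12 * x ^+ 2) <= integ (J * 'X^r).
  rewrite I3 ler_pM2l // -addrA lerDl.
  have -> : 8 * a ^+ 2 + 12 * a - 8 = 8 * (a * (a + 1)) + 4 * (a - 2) by ring.
  have aa : 0 < a * (a + 1) by rewrite mulr_gt0; lra.
  have h1 : 0 < (8 * (a * (a + 1)) + 4 * (a - 2)) * x by rewrite mulr_gt0; lra.
  have h2 : 0 < 2 * a * (a - 1) * (a + 1) * (a + 2) by rewrite !mulr_gt0; lra.
  lra.
have aa : 0 < a * (a + 1) by rewrite mulr_gt0; lra.
have K2 : integ (J * 'X^(r.+1)) * m.+2%:R ^+ 2 <=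
    (2 + a * (a + 1)) * D * integ (J * 'X^r).
  have C0 : 0 <= (2 + a * (a + 1)) * D by rewrite mulr_ge0 //; lra.
  apply: le_trans (ler_wpM2l C0 K3); rewrite I2 -/D.
  by apply: moment_ratio => //; first [exact: ltW|exact: sqr_ge0].
have rf := fact0 r.
have -> : (integ (J * 'X^r) / r`!%:R)^-1 * (integ (J * 'X^(r.+1)) / (r.+1%:R * r`!%:R)) * m.+2%:R ^+ 2
    = integ (J * 'X^(r.+1)) * m.+2%:R ^+ 2 / integ (J * 'X^r) / r.+1%:R.
  by field; rewrite nat1r pnatr_eq0 !gt_eqF.
rewrite ler_pdivrMr ?ltr0n // ler_pdivrMr //.
rewrite (le_trans K2) // [X in _ <= X](mulrAC _ r.+1%:R) ler_peMr //.
  have C0 : 0 <= (2 + a * (a + 1)) * D by rewrite mulr_ge0 //; lra.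
  by rewrite mulr_ge0 // ltW.
by rewrite ler1n.
Qed.
End Profile.

(** * Bernstein polynomials and finite differences *)

Section Bernstein.
Variable R : realType.
Implicit Types (p : {poly R}) (u v : nat -> R).

Fixpoint fdiff k u (i : nat) : R :=
  if k is k'.+1 then fdiff k' u i.+1 - fdiff k' u i else u i.

Lemma fdiffE k u i : fdiff k u i = \sum_(l < k.+1) 'C(k, l)%:R * (-1) ^+ (k - l) * u (i + l)%N.
Proof.
elim: k i => [|k IH] i; first by rewrite big_ord1 /= bin0 expr0 !mul1r addn0.
rewrite /= !IH.
have -> : \sum_(l < k.+1) 'C(k, l)%:R * (-1) ^+ (k - l) * u (i + l)%N =
  \sum_(l < k.+2) 'C(k, l)%:R * (-1) ^+ (k - l) * u (i + l)%N.
  by rewrite [RHS]big_ord_recr /= bin_small // !mul0r addr0.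
rewrite [X in _ - X = _]big_ord_recl [RHS]big_ord_recl /= !bin0 !subn0 opprD addrCA; congr (_ + _).
  by rewrite exprS; ring.
rewrite -sumrB; apply: eq_bigr => l _ /=.
rewrite /bump /= !add1n binS natrD subSS addSnnS.
have [lk|kl] := ltnP l k; last first.
  by rewrite (@bin_small k l.+1) //; ring.
by rewrite -(subnSK lk) exprS; ring.
Qed.

(** The data are nodal values rather than a function, so that the differences in the derivative
    formula are again data of the same kind. *)
Definition bern n u : {poly R} :=
  \sum_(i < n.+1) (u i * 'C(n, i)%:R) *: ('X^i * (1 - 'X) ^+ (n - i)).

Lemma deriv_bern n u :
  (bern n.+1 u)^`() = n.+1%:R *: bern n (fun i => u i.+1 - u i).
Proof.
have d1X : (1 - 'X : {poly R})^`() = -1 by rewrite derivB derivX -[1]/(1%:P) derivC sub0r.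
have dterm i : (i <= n.+1)%N -> ('X^i * (1 - 'X) ^+ (n.+1 - i) : {poly R})^`() =
   i%:R *: ('X^(i.-1) * (1 - 'X) ^+ (n.+1 - i)) - (n.+1 - i)%:R *: ('X^i * (1 - 'X) ^+ (n - i)).
  move=> ile; rewrite derivM derivXn deriv_exp d1X.
  have -> : (n.+1 - i).-1 = (n - i)%N by lia.
  rewrite -!mul_polyC !polyC_natr -[_ *+ i]mulr_natl -[_ *+ (n.+1 - i)]mulr_natl.
  move: 'X^(i.-1) ((1 - 'X) ^+ (n.+1 - i)) 'X^i ((1 - 'X) ^+ (n - i)) => A B A' B'.
  by move: (i%:R) ((n.+1 - i)%:R) => c c'; ring.
rewrite /bern raddf_sum /=.
under eq_bigr => i _ do rewrite derivZ dterm -1?ltnS // scalerBr !scalerA.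
rewrite big_split /= sumrN big_ord_recl /= mulr0 scale0r add0r.
rewrite [X in _ - X]big_ord_recr /= subnn mulr0 scale0r addr0 -sumrB scaler_sumr.
apply: eq_bigr => i _; rewrite /bump /= add1n subSS scalerA -scalerBl; congr (_ *: _).
have i_le : (i <= n)%N by rewrite -ltnS.
have e1 : 'C(n.+1, i.+1)%:R * i.+1%:R = n.+1%:R * 'C(n, i)%:R :> R.
  by rewrite -!natrM mulnC mul_bin_diag.
have e2 : 'C(n.+1, i)%:R * (n.+1 - i)%:R = n.+1%:R * 'C(n, i)%:R :> R.
  by rewrite -!natrM mulnC mul_bin_down.
by rewrite -mulrA e1 -mulrA e2; ring.
Qed.

Lemma bern0 n u : (bern n u).[0] = u 0%N.
Proof.
rewrite /bern horner_sum big_ord_recl big1 => [|i _]; rewrite hornerZ hornerM hornerXn horner_exp hornerD hornerN hornerX hornerC.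
  by rewrite expr0 bin0 subr0 expr1n !mulr1 addr0.
by rewrite /= expr0n mul0r mulr0.
Qed.

Lemma bern1 n u : (bern n u).[1] = u n.
Proof.
rewrite /bern horner_sum big_ord_recr big1 => [|i _]; rewrite hornerZ hornerM hornerXn horner_exp hornerD hornerN hornerX hornerC subrr.
  by rewrite /= subnn expr0 expr1n binn !mulr1 add0r.
by rewrite /= expr0n subn_eq0 leqNgt ltn_ord mulr0 mulr0.
Qed.

Lemma size_bern n u : (size (bern n u) <= n.+1)%N.
Proof.
rewrite (leq_trans (size_sum _ _ _)) //; apply/bigmax_leqP => i _.
rewrite (leq_trans (size_scale_leq _ _)) // (leq_trans (size_polyMleq _ _)) // size_polyXn /=.
have s1 : size (1 - 'X : {poly R}) = 2 by rewrite -opprB size_polyN -[1]/(1%:P) size_XsubC.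
have := size_poly_exp_leq (1 - 'X : {poly R}) (n - i); rewrite s1 mul1n => le.
by rewrite (leq_trans (leq_add (leqnn i) le)) //; have := ltn_ord i; lia.
Qed.

Lemma bern_ge0 n u : (forall i, (i <= n)%N -> 0 <= u i) -> nonneg01 (bern n u).
Proof.
move=> u0 x x01; rewrite /bern horner_sum sumr_ge0 // => i _.
rewrite hornerZ hornerM hornerXn horner_exp hornerD hornerN hornerX hornerC.
have : 0 <= u i by rewrite u0 // -ltnS.
by move=> ui; rewrite !mulr_ge0 ?exprn_ge0 //; lra.
Qed.

Lemma bern_linear n a u v :
  bern n (fun i => a * u i + v i) = a *: bern n u + bern n v.
Proof.
rewrite /bern scaler_sumr -big_split; apply: eq_bigr => i _ /=.
by rewrite scalerA -scalerDl; congr (_ *: _); ring.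
Qed.

Lemma eq_bern n u v : (forall i, (i <= n)%N -> u i = v i) -> bern n u = bern n v.
Proof. by move=> e; apply: eq_bigr => i _; rewrite e // -ltnS. Qed.

Lemma derivn_bern_ge0 k n u :
  (forall i, (i + k <= n)%N -> 0 <= fdiff k u i) -> nonneg01 (bern n u)^`(k).
Proof.
elim: k n u => [|k IH] n u u0; first by apply: bern_ge0 => i le; apply: u0; rewrite addn0.
case: n u0 => [|n] u0.
  by move=> x _; rewrite derivn_poly0 ?horner0 // (leq_trans (size_bern _ _)).
rewrite derivSn deriv_bern derivnZ => x x01; rewrite hornerZ mulr_ge0 // IH // => i le.
have fdS j : fdiff k (fun i => u i.+1 - u i) j = fdiff k.+1 u j.
  elim: k j {IH u0 le} => [|k IHk] j //=; by rewrite !IHk.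
by rewrite fdS u0 // addnS.
Qed.

Lemma bern_const n a : bern n (fun=> a) = a%:P.
Proof.
apply: poly_eq_deriv; last by rewrite bern0 hornerC.
case: n => [|n].
  by rewrite /bern big_ord1 /= !expr0 mulr1 -mul_polyC !mulr1.
by rewrite deriv_bern derivC subrr; rewrite (_ : bern n _ = 0) ?scaler0 // /bern big1 // => i _; rewrite mul0r scale0r.
Qed.

Lemma bern_X n : (0 < n)%N -> bern n (fun i => i%:R / n%:R) = 'X.
Proof.
case: n => // n _; apply: poly_eq_deriv; last by rewrite bern0 hornerX mul0r.
rewrite deriv_bern (@eq_bern _ _ (fun=> n.+1%:R^-1)); last first.
  by move=> i _; rewrite -mulrBl -natr1 addrAC subrr add0r mul1r.
by rewrite bern_const derivX -mul_polyC -polyCM mulfV // pnatr_eq0.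
Qed.

Lemma bern_X1X n : (0 < n)%N ->
  bern n (fun i => i%:R / n%:R * (1 - i%:R / n%:R)) = (1 - n%:R^-1) *: ('X * (1 - 'X)).
Proof.
case: n => // n _.
have n0 : n.+1%:R != 0 :> R by rewrite pnatr_eq0.
apply: poly_eq_deriv; last by rewrite bern0 hornerZ hornerM hornerX !mul0r mulr0.
have d1X : (1 - 'X : {poly R})^`() = -1 by rewrite derivB derivX -[1]/(1%:P) derivC sub0r.
rewrite deriv_bern derivZ derivM derivX d1X.
case: n n0 => [|n] n0.
  rewrite invr1 subrr scale0r /bern big_ord1 /= !mul0r.
  by rewrite !mulr1 subrr mulr0 subr0 ?mul0r scale0r scaler0.
rewrite (@eq_bern _ _ (fun i => (- 2 * n.+1%:R / n.+2%:R ^+ 2) * (i%:R / n.+1%:R) + n.+1%:R / n.+2%:R ^+ 2)).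
  rewrite bern_linear bern_X // bern_const -!mul_polyC.
  move: n0; rewrite -[n.+2%:R]natr1; move: (n.+1%:R : R) => N N0.
  have -> : - 2 * N / (N + 1) ^+ 2 = (N + 1)^-1 * (- 2 * (1 - (N + 1)^-1)) by field.
  have -> : N / (N + 1) ^+ 2 = (N + 1)^-1 * (1 - (N + 1)^-1) by field.
  rewrite !(polyCM (N + 1)^-1) -mulrA -mulrDr mulrA -polyCM mulfV // mul1r.
  by rewrite polyCM polyCN; ring.
move=> i _; have : n.+1%:R != 0 :> R by rewrite pnatr_eq0.
move: n0; rewrite -[i.+1%:R]natr1 -[n.+2%:R]natr1.
move: (i%:R : R) (n.+1%:R : R) => I N N1 N0; field.
by rewrite N0 N1.
Qed.

Lemma poly_fdiff_ge0 k p (a b d : R) : 0 <= d -> a + k%:R * d <= b ->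
  (forall x, a <= x <= b -> 0 <= (p^`(k)).[x]) ->
  0 <= fdiff k (fun i => p.[a + i%:R * d]) 0.
Proof.
elim: k p b => [|k IH] p b d0 ab pk.
  by rewrite /= mul0r addr0; apply: pk; rewrite lexx /=; move: ab; rewrite mul0r addr0.
have fdS u j : fdiff k (fun i => u i.+1 - u i) j = fdiff k.+1 u j.
  elim: k j {IH pk ab} => [|k IHk] j //=; by rewrite !IHk.
rewrite -fdS; pose q := (p \Po ('X + d%:P)) - p.
have -> : (fun i => p.[a + i.+1%:R * d] - p.[a + i%:R * d]) = (fun i => q.[a + i%:R * d]).
  apply/funext => i; rewrite /q hornerD hornerN horner_comp !hornerE.
  by congr (p.[_] - _); rewrite -natr1; ring.
have dcomp (r : {poly R}) n : (r \Po ('X + d%:P))^`(n) = r^`(n) \Po ('X + d%:P).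
  by elim: n => [//|n IHn]; rewrite !derivnS IHn deriv_comp derivD derivX derivC addr0 mulr1.
apply: (IH q (b - d)) => //; first by move: ab; rewrite -natr1 mulrDl mul1r addrA -lerBrDr.
move=> x /andP[ax xb]; rewrite /q derivnB dcomp hornerD hornerN horner_comp !hornerE subr_ge0.
apply: poly_ndecr; first by rewrite lerDl.
by move=> t /andP[xt tx]; rewrite -derivnS pk // (le_trans ax xt) (le_trans tx) // -lerBrDr.
Qed.

Lemma kmonotone_poly k p : nonneg01 p^`(k) -> kmonotone k (fun x => p.[x]).
Proof.
move=> pk; split; first by apply: continuous_subspaceT => x; exact: continuous_horner.
move=> d x d0 x01; rewrite /symdiff; case: ifP => // /andP[].
rewrite !in_itv /= => /andP[a0 a1] /andP[b0 b1].
have := @poly_fdiff_ge0 k p (x - k%:R * d / 2) 1 d (ltW d0).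
rewrite fdiffE; apply; first by lra.
by move=> t /andP[t0 t1]; apply: pk; rewrite t1 (le_trans a0 t0).
Qed.

Lemma kmonotone_fdiff k n (f : R -> R) i : (0 < n)%N -> (i + k <= n)%N -> kmonotone k f ->
  0 <= fdiff k (fun i => f (i%:R / n%:R)) i.
Proof.
move=> n0 ikn [_ fk]; have n0' : 0 < n%:R :> R by rewrite ltr0n.
(* The centre of the symmetric difference of step 1/n whose leftmost node is i/n. *)
pose x : R := i%:R / n%:R + k%:R * n%:R^-1 / 2.
have e1 : x - k%:R * n%:R^-1 / 2 = i%:R / n%:R by rewrite /x addrK.
have e2 : x + k%:R * n%:R^-1 / 2 = (i + k)%:R / n%:R by rewrite /x natrD; field; rewrite gt_eqF.
have i1 : (i%:R / n%:R : R) \in `[0, 1]%R.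
  rewrite in_itv /= divr_ge0 //= ler_pdivrMr // mul1r ler_nat; lia.
have i2 : ((i + k)%:R / n%:R : R) \in `[0, 1]%R.
  by rewrite in_itv /= divr_ge0 //= ler_pdivrMr // mul1r ler_nat.
have x01 : x \in `[0, 1]%R.
  move: i1 i2; rewrite -e2 !in_itv /= => /andP[h1 _] /andP[h2 h3].
  have : 0 <= k%:R * n%:R^-1 / 2 :> R by rewrite !mulr_ge0 // invr_ge0 ltW.
  by rewrite /x in h2 h3 *; lra.
have := fk n%:R^-1 x (_ : 0 < n%:R^-1) x01.
rewrite /symdiff e1 e2 i1 i2 /= invr_gt0 n0' => /(_ isT).
rewrite fdiffE (eq_bigr (fun l : 'I_k.+1 => 'C(k, l)%:R * (-1) ^+ (k - l) * f ((i + l)%:R / n%:R))) //.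
by move=> l _; rewrite natrD mulrDl.
Qed.
End Bernstein.

(** * The multiplier composed with the Bernstein operator *)

Section ShapeOperator.
Variable R : realType.
Implicit Types (p : {poly R}).

(** The degree bound is asked only on Bernstein polynomials, because for small n the operator T is
    the identity. In [so_X1X] the argument is the Bernstein image of x(1-x), so mu is the eigenvalue
    of the composite operator. *)
Record shape_op (q n N : nat) (C : R) (T : {poly R} -> {poly R}) : Prop := ShapeOp {
  so_linear : forall a p1 p2, T (a *: p1 + p2) = a *: T p1 + T p2;
  so_size : forall u, (size (T (bern N u)) <= n.+1)%N;
  so_shape : forall k p, (k <= q)%N -> nonneg01 p^`(k) -> nonneg01 (T p)^`(k);
  so_const : forall a, T a%:P = a%:P;
  so_X : T 'X = 'X;
  so_at0 : forall p, (T p).[0] = p.[0];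
  so_at1 : forall p, (T p).[1] = p.[1];
  so_X1X : exists2 mu, 1 - mu <= C / n%:R ^+ 2 &
    T ((1 - N%:R^-1) *: ('X * (1 - 'X))) = mu *: ('X * (1 - 'X)) }.

Lemma shape_op_exists q : exists C : R, 0 <= C /\ forall n, (0 < n)%N ->
  exists N, (0 < N)%N /\ exists T, shape_op q n N C T.
Proof.
(* Order q+1 rather than q: positivity at level 0 already uses F', also when q = 0. *)
have [C0 C00 prof] := @profile_exists R q.+1.
set r := q.+1 in prof *.
have r3 : 0 <= (r.+3)%:R ^+ 2 :> R by rewrite sqr_ge0.
(* The first term bounds the loss of the multiplier, through n <= 2(r+3)(m+2). The term r+5 pays for
   the small n and, for large n, for the contribution 1 of the Bernstein step. *)
exists (8 * r.+3%:R ^+ 2 * C0 + r%:R + 5); split.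
  by rewrite !addr_ge0 // !mulr_ge0.
move=> n n0; have n0' : 0 < n%:R :> R by rewrite ltr0n.
have n2 : 0 < n%:R ^+ 2 :> R by rewrite exprn_gt0.
have c1 : 0 <= 8 * r.+3%:R ^+ 2 * C0 by rewrite !mulr_ge0.
(* For small n, where the degree bound of the profile does not fit, the plain Bernstein operator has
   1 - mu = 1/n, at most (r+5)/n^2. *)
have [nr|rn] := ltnP n (r + 5).
  exists n; split=> //; exists id; split=> //; first by move=> u; exact: size_bern.
  exists (1 - n%:R^-1) => //; rewrite opprB addrCA subrr addr0 ler_pdivlMr // expr2 mulKf ?gt_eqF //.
  have : n%:R <= r%:R + 5 :> R by rewrite -natrD ler_nat ltnW.
  by lra.
set m := (n - (r + 5))./2.
have [F [szF F1 F0 FC]] := prof m.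
(* With n^2 nodes the Bernstein eigenvalue is 1 - n^-2, of the same order as that of the
   multiplier. *)
exists (n ^ 2)%N; split; first by rewrite expn_gt0 n0.
exists (Op F).
have sz u : (size (Op F u) <= n.+1)%N.
  by apply: size_Op; apply: (leq_trans szF); rewrite /m; lia.
have hmu : 0 <= integ (F * (1 - 'X)).
  apply: integ_ge0 => x x01; rewrite !hornerE mulr_ge0 //; last by lra.
  exact: (F0 0%N).
split=> //.
- by move=> a p1 p2; exact: Op_linear.
- case=> [|k] p kq pk.
    by apply: Op_ge0 => //; [exact: (F0 0%N)|exact: (F0 1%N)].
  rewrite Op_derivn //=; apply: Kop_ge0 => //; apply: F0; exact: leq_trans (leqnSn _) (leq_trans kq (leqnSn _)).
- by move=> a; exact: Op_const.
- exact: Op_X.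
- by move=> p; exact: Op_at0.
- by move=> p; exact: Op_at1.
set mu := 1 - integ (F * (1 - 'X)) *+ 2.
exists ((1 - (n ^ 2)%:R^-1) * mu); last first.
  rewrite -[(1 - _) *: _]addr0 Op_linear Op_X1X // scalerA -/mu.
  by rewrite -[0]/(0%:P) Op_const // addr0.
rewrite natrX ler_pdivlMr //.
have -> : (1 - (1 - (n%:R ^+ 2)^-1) * mu) * n%:R ^+ 2 =
    (1 - mu) * n%:R ^+ 2 + mu by field; rewrite gt_eqF.
have nm : (n <= 2 * r.+3 * m.+2)%N.
  have h d k : (r + 5 <= d -> (d - (r + 5))./2 = k -> d <= 2 * k.+2 + r + 2)%N by lia.
  have := h n m rn erefl; move: (m) => k; nia.
have nm2 : n%:R ^+ 2 <= 4 * r.+3%:R ^+ 2 * m.+2%:R ^+ 2 :> R.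
  have -> : 4 * r.+3%:R ^+ 2 * m.+2%:R ^+ 2 = (2 * r.+3 * m.+2)%:R ^+ 2 :> R.
    by rewrite !natrM; ring.
  by rewrite ler_pXn2r ?nnegrE // ler_nat.
have e1 : (1 - mu) * n%:R ^+ 2 <= 8 * r.+3%:R ^+ 2 * C0.
  have -> : 1 - mu = 2 * integ (F * (1 - 'X)) by rewrite /mu; ring.
  apply: (@le_trans _ _ (2 * integ (F * (1 - 'X)) * (4 * r.+3%:R ^+ 2 * m.+2%:R ^+ 2))).
    by rewrite ler_wpM2l // mulr_ge0.
  have -> : 2 * integ (F * (1 - 'X)) * (4 * r.+3%:R ^+ 2 * m.+2%:R ^+ 2) =
    8 * r.+3%:R ^+ 2 * (integ (F * (1 - 'X)) * m.+2%:R ^+ 2) by ring.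
  by rewrite ler_wpM2l // mulr_ge0.
have e2 : mu <= 1 by rewrite /mu lerBlDr lerDl mulrn_wge0.
by have := ler0n R r; lra.
Qed.

Lemma bern_delta N (u : nat -> R) : bern N u =
  \sum_(i < N.+1) u i *: bern N (fun j => (j == i)%:R).
Proof.
have bE (i : 'I_N.+1) : bern N (fun j => (j == i)%:R : R) =
    'C(N, i)%:R *: ('X^i * (1 - 'X) ^+ (N - i)).
  rewrite /bern (bigD1 i) //= eqxx mul1r big1 ?addr0 // => j ji.
  by rewrite -val_eqE /= in ji; rewrite (negbTE ji) mul0r scale0r.
by rewrite {1}/bern; apply: eq_bigr => i _; rewrite bE scalerA.
Qed.

(** The weights are the values at x of T on the Bernstein basis; they are nonnegative by shape
    preservation at level 0. *)
Lemma shape_op_weights q n N C T (x : R) : shape_op q n N C T -> 0 <= x <= 1 ->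
  exists2 w : nat -> R, forall i, 0 <= w i &
  forall u, (T (bern N u)).[x] = \sum_(i < N.+1) w i * u i.
Proof.
move=> sT x01; exists (fun i => (T (bern N (fun j => (j == i)%:R))).[x]).
  move=> i; apply: (so_shape sT (k := 0) _ _ x01) => //.
  by apply: bern_ge0 => j _; exact: ler0n.
have T0 : T 0 = 0 by rewrite -[X in T X](_ : 0%:P = 0) ?(so_const sT).
move=> u; rewrite [in LHS]bern_delta.
have -> : forall (I : Type) (s : seq I) (a : I -> R) (P : I -> {poly R}),
    T (\sum_(i <- s) a i *: P i) = \sum_(i <- s) a i *: T (P i).
  move=> I s a P; elim: s => [|i s IH]; first by rewrite !big_nil.
  by rewrite !big_cons (so_linear sT) IH.
by rewrite horner_sum; apply: eq_bigr => i _; rewrite hornerZ mulrC.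
Qed.
End ShapeOperator.

(** * Comparison principle, Jensen's inequality with defect, and the modulus *)

Section Comparison.
Variable R : realType.
Implicit Types (f g v s : R -> R).

Definition diff2 f (u d : R) : R := f (u + d) - 2 * f u + f (u - d).

(** Let G be f - W v minus its chord, and c a minimum of G, where second differences of G are
    nonnegative. If the full step [s c] fits in the interval, the hypotheses make that difference
    negative, a contradiction. Otherwise an endpoint is closer than [s c]; a shorter step reaches
    it, G vanishes there, and the bound on the difference gives G(c) > -W. *)
Lemma comparison f v s (W t1 t2 : R) :
  0 < W -> {within `[t1, t2], continuous f} -> {within `[t1, t2], continuous v} ->
  (forall u, t1 < u < t2 -> 0 < s u) ->
  (forall u d, t1 < u < t2 -> 0 < d <= s u -> t1 <= u - d -> u + d <= t2 -> diff2 f u d < W) ->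
  (forall u d, 0 < d -> t1 <= u - d -> u + d <= t2 -> 0 <= diff2 v u d) ->
  (forall u, t1 < u < t2 -> t1 <= u - s u -> u + s u <= t2 -> 1 <= diff2 v u (s u)) ->
  forall x, t1 < x < t2 ->
  (t2 - x) * (f t1 - W * v t1) + (x - t1) * (f t2 - W * v t2) <=
  (t2 - t1) * (f x - W * v x + W).
Proof.
move=> W0 cf cv s0 hf hv hv1 x /andP[t1x xt2].
have t12 : t1 < t2 by exact: lt_trans xt2.
pose g u := f u - W * v u.
pose l := (g t2 - g t1) / (t2 - t1).
have d0 : t2 - t1 != 0 by rewrite subr_eq0 gt_eqF.
pose G u := g u - g t1 - l * (u - t1).
have G1 : G t1 = 0 by rewrite /G !subrr mulr0 subr0.
have G2 : G t2 = 0 by rewrite /G /l mulfVK // subrr.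
have dG u d : diff2 G u d = diff2 f u d - W * diff2 v u d.
  by rewrite /diff2 /G /g; ring.
have cG : {within `[t1, t2], continuous G}.
  have ca : {within `[t1, t2], continuous (fun u => g t1 + l * (u - t1))}.
    apply: continuous_subspaceT => z; apply: cvgD; first exact: cvg_cst.
    by apply: cvgM; [exact: cvg_cst|apply: cvgB; [exact: cvg_id|exact: cvg_cst]].
  have -> : G = (fun u => (f u - W * v u) - (g t1 + l * (u - t1))).
    by apply/funext => u; rewrite /G /g; ring.
  move=> z; apply: cvgB; last exact: ca.
  by apply: cvgB; [exact: cf|apply: cvgM; [exact: cvg_cst|exact: cv]].
have [c] := EVT_min (ltW t12) cG; rewrite in_itv /= => /andP[t1c ct2] cmin.
have xin : x \in `[t1, t2] by rewrite in_itv /= !ltW.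
suff Gc : - W <= G c.
  have := le_trans Gc (cmin x xin); rewrite /G => Gx.
  have -> : (t2 - x) * (f t1 - W * v t1) + (x - t1) * (f t2 - W * v t2) =
    (t2 - t1) * (g t1 + l * (x - t1)).
    by rewrite /l /g; field.
  by rewrite ler_wpM2l ?subr_ge0 ?(ltW t12) // -/(g x); lra.
move: t1c; rewrite le_eqVlt => /predU1P [<-|t1c]; first by rewrite G1 oppr_le0 ltW.
move: ct2; rewrite le_eqVlt => /predU1P [->|ct2]; first by rewrite G2 oppr_le0 ltW.
have c12 : t1 < c < t2 by rewrite t1c.
have Gge t : t1 <= t <= t2 -> G c <= G t by move=> tt; apply: cmin; rewrite in_itv.
have sc := s0 _ c12.
have [/andP[sc1 sc2]|] := boolP ((t1 <= c - s c) && (c + s c <= t2)).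
  have := hf c (s c) c12; rewrite sc lexx => /(_ isT sc1 sc2) h1.
  have h2 := hv1 c c12 sc1 sc2.
  have h3 : G c <= G (c - s c) by apply: Gge; rewrite sc1 /=; lra.
  have h4 : G c <= G (c + s c) by apply: Gge; rewrite sc2 andbT; lra.
  have := dG c (s c); rewrite {1}/diff2 => e.
  have h5 : W <= W * diff2 v c (s c) by rewrite ler_peMr // ltW.
  by lra.
move=> ns; have {ns} ns : c - t1 < s c \/ t2 - c < s c.
  by move: ns; rewrite negb_and -!ltNge => /orP [h|h]; [left|right]; lra.
(* The step goes to the nearer endpoint, so that its mirror image stays in the interval. *)
have [le|gt] := lerP (c - t1) (t2 - c).
  have dd : 0 < c - t1 <= s c by rewrite subr_gt0 t1c /=; case: ns; lra.
  have a1 : t1 <= c - (c - t1) by lra.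
  have a2 : c + (c - t1) <= t2 by lra.
  have h1 := hf c _ c12 dd a1 a2.
  have dd0 : 0 < c - t1 by lra.
  have h2 := hv c _ dd0 a1 a2.
  have h4 : G c <= G (c + (c - t1)) by apply: Gge; rewrite a2 andbT; lra.
  have := dG c (c - t1); rewrite {1}/diff2 (_ : c - (c - t1) = t1) ?G1; last by ring.
  have h5 : 0 <= W * diff2 v c (c - t1) by rewrite mulr_ge0 // ltW.
  by lra.
have dd : 0 < t2 - c <= s c by rewrite subr_gt0 ct2 /=; case: ns; lra.
have a1 : t1 <= c - (t2 - c) by lra.
have a2 : c + (t2 - c) <= t2 by lra.
have h1 := hf c _ c12 dd a1 a2.
have dd0 : 0 < t2 - c by lra.
have h2 := hv c _ dd0 a1 a2.
have h4 : G c <= G (c - (t2 - c)) by apply: Gge; rewrite a1 /=; lra.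
have := dG c (t2 - c); rewrite {1}/diff2 (_ : c + (t2 - c) = t2) ?G2; last by ring.
have h5 : 0 <= W * diff2 v c (t2 - c) by rewrite mulr_ge0 // ltW.
by lra.
Qed.

(* The slope separating the two sides is the supremum of the slopes of chords
   to the right of [x]. *)
Lemma supporting_line g (W x : R) : 0 <= W -> 0 < x < 1 ->
  (forall t1 t2, 0 <= t1 -> t1 < x < t2 -> t2 <= 1 ->
    (t2 - x) * g t1 + (x - t1) * g t2 <= (t2 - t1) * (g x + W)) ->
  exists p, forall t, 0 <= t <= 1 -> g t <= g x + W + p * (t - x).
Proof.
move=> W0 /andP[x0 x1] chord.
pose A := [set (g t - g x - W) / (t - x) | t in [set t | x < t <= 1]].
have ubA t : 0 <= t < x -> ubound A ((g x + W - g t) / (x - t)).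
  move=> /andP[t0 tx] _ [z /= /andP[xz z1] <-].
  have zx : 0 < z - x by rewrite subr_gt0.
  have xt : 0 < x - t by rewrite subr_gt0.
  rewrite ler_pdivrMr // mulrAC ler_pdivlMr //.
  by have := chord t z t0 (introT andP (conj tx xz)) z1; lra.
have hA : has_sup A.
  split; last by exists ((g x + W - g 0) / (x - 0)); apply: ubA; rewrite lexx.
  by exists ((g 1 - g x - W) / (1 - x)), 1 => //=; rewrite x1 lexx.
exists (sup A) => t /andP[t0 t1].
have [tx|xt|->] := ltgtP t x; last by rewrite subrr mulr0 addr0 lerDl.
  have xt : 0 < x - t by rewrite subr_gt0.
  have := ge_sup hA.1 (ubA t (introT andP (conj t0 tx))).
  by rewrite ler_pdivlMr //; lra.
have zx : 0 < t - x by rewrite subr_gt0.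
have : (g t - g x - W) / (t - x) <= sup A.
  by apply: ub_le_sup; [exact: hA.2|exists t => //=; rewrite xt].
by rewrite ler_pdivrMr //; lra.
Qed.

(** Jensen's inequality with defect [W]: averaging the supporting line removes its linear term,
    since the barycentre is x. *)
Lemma mean_bound g (W x : R) N (w t : nat -> R) : 0 <= W -> 0 < x < 1 ->
  (forall t1 t2, 0 <= t1 -> t1 < x < t2 -> t2 <= 1 ->
    (t2 - x) * g t1 + (x - t1) * g t2 <= (t2 - t1) * (g x + W)) ->
  (forall i, 0 <= w i) -> (forall i, (i < N)%N -> 0 <= t i <= 1) ->
  \sum_(i < N) w i = 1 -> \sum_(i < N) w i * t i = x ->
  \sum_(i < N) w i * g (t i) <= g x + W.
Proof.
move=> W0 x01 /(supporting_line W0 x01) [p hp] w0 t01 w1 wt.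
have -> : g x + W = \sum_(i < N) w i * (g x + W + p * (t i - x)).
  rewrite (eq_bigr (fun i : 'I_N => w i * (g x + W - p * x) + p * (w i * t i))); last first.
    by move=> i _; ring.
  by rewrite big_split /= -mulr_suml -mulr_sumr w1 wt; ring.
by apply: ler_sum => i _; rewrite ler_wpM2l // hp // t01.
Qed.

Lemma cont01_bounded f : cont01 f -> exists2 B : R, 0 <= B & forall x, 0 <= x <= 1 -> `|f x| <= B.
Proof.
move=> cf.
have [a _ amin] := EVT_min (@ler01 R) cf.
have [b _ bmax] := EVT_max (@ler01 R) cf.
exists (`|f a| + `|f b|); first by rewrite addr_ge0.
move=> x x01; have xin : x \in `[0, 1] by rewrite in_itv.
have h1 := amin x xin; have h2 := bmax x xin.
rewrite ler_norml; have := ler_norm (f b); have := lerNnormlW (lexx `|f a|).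
by have := normr_ge0 (f a); have := normr_ge0 (f b); lra.
Qed.

Lemma sum_diff2 f x d :
  \sum_(i < 3) 'C(2, i)%:R * (-1) ^+ (2 - i) * f (x - 2%:R * d / 2 + i%:R * d) = diff2 f x d.
Proof.
have e0 : x - 2%:R * d / 2 + 0%:R * d = x - d by field.
have e1 : x - 2%:R * d / 2 + 1%:R * d = x by field.
have e2 : x - 2%:R * d / 2 + 2%:R * d = x + d by field.
have := fdiffE 2 (fun i => f (x - 2%:R * d / 2 + i%:R * d)) 0.
move=> <-; rewrite /fdiff e0 e1 e2 /diff2; ring.
Qed.

Lemma symdiff2E (d : R) f u : 0 <= u - d -> u + d <= 1 -> 0 <= d ->
  symdiff 2 d f u = diff2 f u d.
Proof.
move=> h1 h2 d0; rewrite /symdiff sum_diff2.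
have -> : 2%:R * d / 2 = d by field.
have h3 : u - d <= 1 by lra.
have h4 : 0 <= u + d by lra.
by rewrite !in_itv /= h1 h2 h3 h4.
Qed.

Lemma omega2_has_ub f psi (h : R) : cont01 f ->
  has_ubound [set supnorm01 (fun x => symdiff 2 (k * psi x) f x) | k in `]0, h]]
  /\ forall d x, x \in `[0, 1]%R -> `|symdiff 2 (d * psi x) f x| <= supnorm01 (fun x => symdiff 2 (d * psi x) f x).
Proof.
move=> cf; have [B B0 fB] := cont01_bounded cf.
have bd d x : `|symdiff 2 d f x| <= 4 * B.
  rewrite /symdiff; case: ifP => [|_]; last by rewrite normr0 mulr_ge0.
  rewrite !in_itv /= => /andP[/andP[a0 a1] /andP[b0 b1]].
  have ed : 2%:R * d / 2 = d by field.
  rewrite ed in a0 a1 b0 b1; rewrite sum_diff2 /diff2.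
  have h1 := fB (x - d) (introT andP (conj a0 a1)).
  have h2 := fB (x + d) (introT andP (conj b0 b1)).
  have h3 : `|f x| <= B by apply: fB; apply/andP; split; lra.
  move: h1 h2 h3; rewrite !ler_norml => /andP[? ?] /andP[? ?] /andP[? ?].
  by apply/andP; split; lra.
have hs d : has_sup [set `|symdiff 2 (d * psi x) f x| | x in `[0, 1]].
  split; first by exists `|symdiff 2 (d * psi 0) f 0|, 0 => //=; rewrite in_itv /= lexx ler01.
  by exists (4 * B) => _ [x _ <-].
split; last by move=> d x xin; apply: ub_le_sup; [exact: (hs d).2|exists x].
exists (4 * B) => _ [d _ <-]; apply: ge_sup; first exact: (hs d).1.
by move=> _ [x _ <-].
Qed.

Lemma omega2_ge f (lambda h u d : R) : cont01 f -> 0 < u < 1 -> 0 < d ->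
  d <= h * phi_pow lambda u -> 0 <= u - d -> u + d <= 1 ->
  `|diff2 f u d| <= omega2 (phi_pow lambda) f h.
Proof.
move=> cf /andP[u0 u1] d0 dh h1 h2.
have p0 : 0 < phi_pow lambda u.
  by rewrite /phi_pow powR_gt0 // /phi sqrtr_gt0 mulr_gt0 // subr_gt0.
have [ub le] := omega2_has_ub (phi_pow lambda) h cf.
have dE : d = d / phi_pow lambda u * phi_pow lambda u by rewrite mulfVK // gt_eqF.
rewrite -(symdiff2E f h1 h2 (ltW d0)) {1}dE.
have uin : u \in `[0, 1]%R by rewrite in_itv /= !ltW.
apply: (le_trans (le (d / phi_pow lambda u) u uin)).
apply: ub_le_sup => //; exists (d / phi_pow lambda u) => //=.
by rewrite in_itv /= divr_gt0 //= ler_pdivrMr.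
Qed.

Lemma omega2_ge0 f psi (h : R) : cont01 f -> 0 < h -> 0 <= omega2 psi f h.
Proof.
move=> cf h0; have [ub le] := omega2_has_ub psi h cf.
have z01 : 0 \in `[0, 1 : R]%R by rewrite in_itv /= lexx ler01.
apply: (le_trans (le_trans (normr_ge0 _) (le h 0 z01))).
by apply: ub_le_sup => //; exists h => //=; rewrite in_itv /= h0 lexx.
Qed.
End Comparison.

(** * Inequalities for powers, and the barrier *)

Section Powers.
Variable R : realType.
Implicit Types (s x p be lambda Y : R).

(** With y = be ln s, e^y is the combination of e^y (1 + ln s - y) and e^y (1 - y) with weights be
    and 1 - be. By 1 + t <= e^t these are at most s and 1. *)
Lemma bernoulli_powR s be : 0 <= s -> 0 < be <= 1 -> s `^ be <= 1 + be * (s - 1).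
Proof.
rewrite le_eqVlt => /predU1P [<-|s0] /andP[b0 b1].
  by rewrite powR0 ?gt_eqF //; lra.
rewrite /powR gt_eqF //; set y := be * ln s.
have h1 := expR_ge1Dx (ln s - y); have h2 := expR_ge1Dx (- y).
have y0 := expR_gt0 y.
have e1 : expR y * expR (ln s - y) = s by rewrite -expRD addrCA subrr addr0 lnK.
have e2 : expR y * expR (- y) = 1 by rewrite -expRD subrr expR0.
have k1 : expR y * (1 + (ln s - y)) <= s by rewrite -[X in _ <= X]e1 ler_wpM2l // ltW.
have k2 : expR y * (1 - y) <= 1 by rewrite -[X in _ <= X]e2 ler_wpM2l // ltW.
have c1 : be * (expR y * (1 + (ln s - y))) <= be * s by rewrite ler_wpM2l // ltW.
have c2 : (1 - be) * (expR y * (1 - y)) <= (1 - be) * 1 by rewrite ler_wpM2l // subr_ge0.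
have -> : expR y = be * (expR y * (1 + (ln s - y))) + (1 - be) * (expR y * (1 - y)).
  by rewrite {2}/y; rewrite {4}/y; rewrite /y; ring.
lra.
Qed.

(** The Bernoulli inequality at 1/s gives s^be >= s / (s + be(1-s)), and the quadratic lies below
    this rational function. *)
Lemma powR_lower s be : 0 <= s -> 0 < be <= 1 ->
  1 + be * (s - 1) - (s - 1) ^+ 2 <= s `^ be.
Proof.
move=> s_ge0 b01; have /andP[b0 b1] := b01.
move: (s_ge0); rewrite le_eqVlt => /predU1P [<-|s0].
  by rewrite powR0 ?gt_eqF // sub0r sqrrN expr1n; lra.
have si0 : 0 < s^-1 by rewrite invr_gt0.
have := bernoulli_powR (ltW si0) b01; set P := s `^ be.
have P0 : 0 < P by exact: powR_gt0.
have -> : s^-1 `^ be = P^-1.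
  by apply: (mulfI (lt0r_neq0 P0)); rewrite -powRM ?ltW // !mulfV ?gt_eqF // powR1.
rewrite -(ler_pM2l s0) -(ler_pM2l P0) => h.
have {}h : s <= P * (s + be * (1 - s)).
  move: h; have -> : P * (s * P^-1) = s by rewrite mulrCA mulfV ?gt_eqF // mulr1.
  by have -> : s * (1 + be * (s^-1 - 1)) = s + be * (1 - s) by field; rewrite gt_eqF.
rewrite leNgt; apply/negP => lt.
have E0 : 0 < s + be * (1 - s) by nra.
have : P * (s + be * (1 - s)) < (1 + be * (s - 1) - (s - 1) ^+ 2) * (s + be * (1 - s)).
  by rewrite ltr_pM2r.
have : (1 + be * (s - 1) - (s - 1) ^+ 2) * (s + be * (1 - s)) <= s.
  rewrite -subr_ge0.
  have -> : s - (1 + be * (s - 1) - (s - 1) ^+ 2) * (s + be * (1 - s)) =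
     (s - 1) ^+ 2 * (be ^+ 2 + (1 - be) * s) by ring.
  by rewrite mulr_ge0 ?sqr_ge0 // addr_ge0 ?sqr_ge0 // mulr_ge0 // subr_ge0.
lra.
Qed.

(** For z = s^(be/3) the power is z^3, while z^4 = s^(4be/3) obeys the Bernoulli inequality as long
    as be <= 3/4. With be = 1 - lambda/2 this is the threshold lambda = 1/2 in [barrier]. The gain
    comes from s = 1-p, where 1 - z >= be p / 3. *)
Lemma powR_diff2 be p : 0 < be <= 3 / 4 -> 0 <= p <= 1 ->
  (1 + p) `^ be + (1 - p) `^ be - 2 <= - (be ^+ 2 / 36 * p ^+ 2).
Proof.
move=> /andP[b0 b1] /andP[p0 p1].
have q0 : 0 <= 1 - p by lra.
have q1 : 0 <= 1 + p by lra.
have cube z : 0 <= z -> z `^ be = (z `^ (be / 3)) ^+ 3.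
  by move=> z0; rewrite -powR_mulrn ?powR_ge0 // -powRrM; congr (_ `^ _); field.
have four z : 0 <= z -> (z `^ (be / 3)) ^+ 4 <= 1 + 4 * be / 3 * (z - 1).
  move=> z0; rewrite -powR_mulrn ?powR_ge0 // -powRrM.
  have -> : be / 3 * 4%:R = 4 * be / 3 by field.
  by apply: bernoulli_powR => //; apply/andP; split; lra.
have h3 : (1 - p) `^ (be / 3) <= 1 + be / 3 * (1 - p - 1).
  by apply: bernoulli_powR => //; apply/andP; split; lra.
have h1 := four _ q0; have h2 := four _ q1.
rewrite !cube //; move: h1 h2 h3.
have := powR_ge0 (1 - p) (be / 3); have := powR_ge0 (1 + p) (be / 3).
move: ((1 - p) `^ (be / 3)) ((1 + p) `^ (be / 3)) => a b b_ge0 a_ge0 h1 h2 h3.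
have k1 : 4 * a ^+ 3 <= 1 + 3 * a ^+ 4 - (1 - a) ^+ 2.
  rewrite -subr_ge0; have -> : 1 + 3 * a ^+ 4 - (1 - a) ^+ 2 - 4 * a ^+ 3 =
    (1 - a) ^+ 2 * (2 * a + 3 * a ^+ 2) by ring.
  by rewrite mulr_ge0 ?sqr_ge0 // addr_ge0 // mulr_ge0 // sqr_ge0.
have k2 : 4 * b ^+ 3 <= 1 + 3 * b ^+ 4.
  rewrite -subr_ge0; have -> : 1 + 3 * b ^+ 4 - 4 * b ^+ 3 =
    (1 - b) ^+ 2 * (1 + 2 * b + 3 * b ^+ 2) by ring.
  by rewrite mulr_ge0 ?sqr_ge0 // !addr_ge0 // mulr_ge0 // sqr_ge0.
have bp : 0 <= be / 3 * p by rewrite mulr_ge0 //; lra.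
have k3 : (be / 3 * p) ^+ 2 <= (1 - a) ^+ 2.
  by rewrite ler_pXn2r ?nnegrE //; lra.
have e : (be / 3 * p) ^+ 2 = 4 * (be ^+ 2 / 36 * p ^+ 2) by field.
by rewrite e in k3; lra.
Qed.

Lemma sqrt_diff2 p : 0 <= p <= 1 ->
  p ^+ 2 / 8 <= (1 + p) * Num.sqrt (1 + p) + (1 - p) * Num.sqrt (1 - p) - 2.
Proof.
move=> /andP[p0 p1].
have a2 : Num.sqrt (1 - p) ^+ 2 = 1 - p by rewrite sqr_sqrtr; lra.
have b2 : Num.sqrt (1 + p) ^+ 2 = 1 + p by rewrite sqr_sqrtr; lra.
have := sqrtr_ge0 (1 - p); have := sqrtr_ge0 (1 + p); move: a2 b2.
move: (Num.sqrt (1 - p)) (Num.sqrt (1 + p)) => a b a2 b2 b0 a0.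
have k3 : p / 2 <= 1 - a.
  have : 0 <= (1 - a) ^+ 2 by exact: sqr_ge0.
  have -> : (1 - a) ^+ 2 = 1 - 2 * a + a ^+ 2 by ring.
  lra.
have k4 : (p / 2) ^+ 2 <= (1 - a) ^+ 2 by rewrite ler_pXn2r ?nnegrE //; lra.
have k1 : 3 * a ^+ 2 - 1 + (1 - a) ^+ 2 <= 2 * (a ^+ 2 * a).
  rewrite -subr_ge0; have -> : 2 * (a ^+ 2 * a) - (3 * a ^+ 2 - 1 + (1 - a) ^+ 2) =
    (1 - a) ^+ 2 * (2 * a) by ring.
  by rewrite mulr_ge0 ?sqr_ge0 // mulr_ge0.
have k2 : 3 * b ^+ 2 - 1 <= 2 * (b ^+ 2 * b).
  rewrite -subr_ge0; have -> : 2 * (b ^+ 2 * b) - (3 * b ^+ 2 - 1) =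
    (1 - b) ^+ 2 * (2 * b + 1) by ring.
  by rewrite mulr_ge0 ?sqr_ge0 // addr_ge0 // mulr_ge0.
have e : (p / 2) ^+ 2 = 2 * (p ^+ 2 / 8) by field.
by rewrite -a2 -b2; rewrite e in k4; rewrite a2 in k1 *; rewrite b2 in k2 *; lra.
Qed.

Lemma continuous_norm_powR be : 0 < be -> continuous (fun t : R => `|t| `^ be).
Proof.
move=> b0 t.
have c0 : (fun t : R => `|t| `^ be) @ (0 : R) --> (0 : R).
  apply/cvgr0Pnorm_lt => e e0.
  apply: filterS (@nbhs0_lt _ R _ (powR_gt0 be^-1 e0)) => z ze.
  rewrite ger0_norm ?powR_ge0 //.
  have -> : e = (e `^ be^-1) `^ be by rewrite -powRrM mulVf ?gt_eqF // powRr1 // ltW.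
  by rewrite gt0_ltr_powR ?nnegrE ?powR_ge0.
have [->|t0] := eqVneq t 0; first by rewrite /continuous_at normr0 powR0 ?gt_eqF.
apply: (@continuous_comp _ _ _ (fun t : R => `|t|) (fun t => t `^ be)).
  exact: norm_continuous.
apply/differentiable_continuous/derivable1_diffP/derivable_powR.
by rewrite in_itv /= andbT normr_gt0.
Qed.

Lemma ler_powR_base (a x y : R) : 0 <= a -> 0 <= x -> x <= y -> x `^ a <= y `^ a.
Proof. by move=> a0 x0 xy; apply: ge0_ler_powR; rewrite ?nnegrE // (le_trans x0). Qed.

(* On [0,1] the second derivative dominates t^(-lambda): the quadratic term for
   t >= Y, the singular term for t < Y.  The power t^(1-lambda/2) degenerates to
   a linear function as lambda tends to 0, hence the other choice there. *)
Definition barrier lambda Y t : R := Y `^ (- lambda) * t ^+ 2 +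
  (if lambda <= 1 / 2 then Y `^ (1 / 2 - lambda) * (t * Num.sqrt t)
   else - (Y `^ (1 - lambda / 2) * `|t| `^ (1 - lambda / 2))).

Lemma barrier_continuous lambda Y : lambda < 2 -> continuous (barrier lambda Y).
Proof.
move=> l2 t; apply: cvgD.
  by apply: cvgM; [exact: cvg_cst|apply: exprn_continuous].
case: ifP => _.
  apply: cvgM; first exact: cvg_cst.
  by apply: cvgM; [exact: cvg_id|exact: sqrt_continuous].
apply: cvgN; apply: cvgM; first exact: cvg_cst.
by apply: continuous_norm_powR; lra.
Qed.

Lemma barrier_diff2 lambda Y u d : 0 <= lambda < 2 -> 0 < Y -> 0 < d <= u ->
  (1 - lambda / 2) ^+ 2 / 36 * (d ^+ 2 * u `^ (- lambda)) <=
  barrier lambda Y (u + d) - 2 * barrier lambda Y u + barrier lambda Y (u - d).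
Proof.
move=> /andP[l0 l2] Y0 /andP[d0 du]; have u0 : 0 < u by lra.
have u_ge0 := ltW u0.
set be := 1 - lambda / 2; have be0 : 0 < be by rewrite /be; lra.
have be1 : be <= 1 by rewrite /be; lra.
have be2 : be ^+ 2 <= 1 by rewrite -[X in _ <= X](expr1n _ 2) ler_pXn2r ?nnegrE // ltW.
have ul0 : 0 < u `^ (- lambda) by exact: powR_gt0.
have D0 : 0 <= d ^+ 2 * u `^ (- lambda) by rewrite mulr_ge0 ?sqr_ge0 // ltW.
pose p := d / u.
have p01 : 0 <= p <= 1 by apply/andP; split; [rewrite divr_ge0 // ltW|rewrite ler_pdivrMr // mul1r].
have dE : d = p * u by rewrite /p mulfVK // gt_eqF.
have upE : u + d = u * (1 + p) by rewrite dE; ring.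
have umE : u - d = u * (1 - p) by rewrite dE; ring.
have p1 : 0 <= 1 + p by lra.
have p2 : 0 <= 1 - p by lra.
(* The singular term yields Y^a u^(-lambda-a), with a = 1/2 - lambda or a = be according to the
   case; for u < Y this dominates u^(-lambda). *)
have mono a : 0 <= a -> u < Y -> u `^ (- lambda) <= Y `^ a * u `^ (- lambda - a).
  move=> a0 uY; rewrite powRB; last by rewrite (gt_eqF u0) implybT.
  rewrite mulrCA; apply: ler_peMr; first exact: ltW.
  by rewrite ler_pdivlMr ?powR_gt0 // mul1r; apply: ler_powR_base => //; exact: ltW.
rewrite /barrier; set Yl := Y `^ (- lambda).
have Yl0 : 0 < Yl by exact: powR_gt0.
have quad : Yl * (u + d) ^+ 2 - 2 * (Yl * u ^+ 2) + Yl * (u - d) ^+ 2 = 2 * Yl * d ^+ 2.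
  by ring.
have quad0 : 0 <= 2 * Yl * d ^+ 2 by rewrite !mulr_ge0 ?sqr_ge0 // ltW.
have far : Y <= u -> be ^+ 2 / 36 * (d ^+ 2 * u `^ (- lambda)) <= 2 * Yl * d ^+ 2.
  move=> Yu; have ule : u `^ (- lambda) <= Yl.
    by rewrite /Yl !powRN lef_pV2 ?posrE ?powR_gt0 //; apply: ler_powR_base => //; exact: ltW.
  have h : d ^+ 2 * u `^ (- lambda) <= Yl * d ^+ 2 by rewrite mulrC ler_wpM2r // sqr_ge0.
  have : be ^+ 2 / 36 * (d ^+ 2 * u `^ (- lambda)) <= 1 * (d ^+ 2 * u `^ (- lambda)).
    by rewrite ler_wpM2r //; lra.
  lra.
case: ifP => [l1|/negbT]; last rewrite -ltNge => l1.
  set Z := Y `^ _; have Z0 : 0 < Z by exact: powR_gt0.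
  have key : Z * (u * Num.sqrt u) * (p ^+ 2 / 8) <=
    Z * ((u + d) * Num.sqrt (u + d)) - 2 * (Z * (u * Num.sqrt u)) + Z * ((u - d) * Num.sqrt (u - d)).
    rewrite upE umE !sqrtrM //.
    have -> : Z * (u * (1 + p) * (Num.sqrt u * Num.sqrt (1 + p))) - 2 * (Z * (u * Num.sqrt u)) +
      Z * (u * (1 - p) * (Num.sqrt u * Num.sqrt (1 - p))) =
      Z * (u * Num.sqrt u) * ((1 + p) * Num.sqrt (1 + p) + (1 - p) * Num.sqrt (1 - p) - 2) by ring.
    apply: ler_wpM2l; last exact: sqrt_diff2.
    by rewrite !mulr_ge0 ?sqrtr_ge0 // ltW.
  have key0 : 0 <= Z * (u * Num.sqrt u) * (p ^+ 2 / 8).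
    apply: mulr_ge0; last by rewrite divr_ge0 ?sqr_ge0.
    by rewrite !mulr_ge0 ?sqrtr_ge0 // ltW.
  have [Yu|uY] := leP Y u; first by have := far Yu; lra.
  have a0 : 0 <= 1 / 2 - lambda by lra.
  have uE : u `^ (- lambda - (1 / 2 - lambda)) = (Num.sqrt u)^-1.
    by rewrite -powR12_sqrt // -powRN; congr (_ `^ _); field.
  have := mono _ a0 uY; rewrite -/Z uE => h.
  have eq1 : Z * (u * Num.sqrt u) * (p ^+ 2 / 8) = (d ^+ 2 * (Z * (Num.sqrt u)^-1)) / 8.
    have su : Num.sqrt u ^+ 2 = u by rewrite sqr_sqrtr // ltW.
    have su0 : Num.sqrt u != 0 by rewrite gt_eqF // sqrtr_gt0.
    rewrite /p; move: su su0; move: (Num.sqrt u) => r <- r0; field.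
    by rewrite r0.
  have h2 : d ^+ 2 * u `^ (- lambda) <= d ^+ 2 * (Z * (Num.sqrt u)^-1).
    by rewrite ler_wpM2l // sqr_ge0.
  have : be ^+ 2 / 36 * (d ^+ 2 * u `^ (- lambda)) <= 1 / 8 * (d ^+ 2 * u `^ (- lambda)).
    by rewrite ler_wpM2r //; lra.
  lra.
rewrite -/be; set Z := Y `^ be; have Z0 : 0 < Z by exact: powR_gt0.
have b34 : 0 < be <= 3 / 4 by rewrite be0 /be; lra.
have ub0 : 0 < u `^ be by exact: powR_gt0.
have key : Z * u `^ be * (be ^+ 2 / 36 * p ^+ 2) <=
  - (Z * `|u + d| `^ be) - 2 * (- (Z * `|u| `^ be)) + - (Z * `|u - d| `^ be).
  have ud : 0 <= u - d by lra.
  have ud' : 0 <= u + d by lra.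
  rewrite !ger0_norm // upE umE !powRM //.
  have -> : - (Z * (u `^ be * (1 + p) `^ be)) - 2 * - (Z * u `^ be) - Z * (u `^ be * (1 - p) `^ be)
    = Z * u `^ be * - ((1 + p) `^ be + (1 - p) `^ be - 2) by ring.
  apply: ler_wpM2l; first by rewrite mulr_ge0 ?ltW.
  by rewrite lerNr powR_diff2.
have key0 : 0 <= Z * u `^ be * (be ^+ 2 / 36 * p ^+ 2).
  apply: mulr_ge0; first by rewrite mulr_ge0 // ltW.
  by rewrite mulr_ge0 ?sqr_ge0 // divr_ge0 ?sqr_ge0.
have [Yu|uY] := leP Y u; first by have := far Yu; lra.
have := mono _ (ltW be0) uY; rewrite -/Z => h.
have eq1 : Z * u `^ be * (be ^+ 2 / 36 * p ^+ 2) = be ^+ 2 / 36 * (d ^+ 2 * (Z * u `^ (- lambda - be))).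
  have -> : u `^ (- lambda - be) = u `^ be / u ^+ 2.
    rewrite -(powR_mulrn 2 u_ge0) -powRB; last by rewrite (gt_eqF u0) implybT.
    by congr (_ `^ _); rewrite /be; field.
  by rewrite /p; field; rewrite gt_eqF.
have : be ^+ 2 / 36 * (d ^+ 2 * u `^ (- lambda)) <= be ^+ 2 / 36 * (d ^+ 2 * (Z * u `^ (- lambda - be))).
  apply: ler_wpM2l; first by rewrite mulr_ge0 ?sqr_ge0 // invr_ge0.
  by rewrite ler_wpM2l // sqr_ge0.
lra.
Qed.
End Powers.

(** * Parabolic upper bounds for the barrier *)

Section BarrierUpper.
Variable R : realType.
Implicit Types (x Y lambda : R) (n : nat).

Definition rate lambda n x : R :=
  phi_pow (2 - lambda) x / (n%:R ^+ 2 * (phi x + n%:R^-1) `^ lambda).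

Lemma rate_ge0 lambda n x : 0 <= rate lambda n x.
Proof. by rewrite divr_ge0 ?mulr_ge0 ?powR_ge0 ?sqr_ge0. Qed.

Lemma phi_gt0 x : 0 < x < 1 -> 0 < phi x.
Proof. by move=> /andP[x0 x1]; rewrite sqrtr_gt0 mulr_gt0 // subr_gt0. Qed.

Lemma phi_sqr x : 0 < x < 1 -> phi x ^+ 2 = x * (1 - x).
Proof. by move=> /andP[x0 x1]; rewrite sqr_sqrtr // mulr_ge0 ?subr_ge0 // ltW. Qed.

Lemma powR_le_sqr (a lambda : R) : 1 <= a -> lambda < 2 -> a `^ lambda <= a ^+ 2.
Proof.
by move=> a1 l2; rewrite -powR_mulrn ?(le_trans ler01) //; apply: ler_powR => //; exact: ltW.
Qed.

(** As phi^2 = phi^(2-lambda) phi^lambda, the claim reduces to (phi (phi + 1/n))^lambda <= 9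
    Y^lambda. The base is at most 3Y, since phi^2 <= Y and phi/n <= 2Y, and 9 bounds 3^lambda. *)
Lemma barrier_rate lambda n x Y : 0 <= lambda < 2 -> (0 < n)%N -> 0 < x < 1 ->
  x <= Y -> (4 * n%:R ^+ 2)^-1 <= Y ->
  Y `^ (- lambda) * (x * (1 - x) / n%:R ^+ 2) <= 9 * rate lambda n x.
Proof.
move=> /andP[l0 l2] n0 x01 xY nY; have /andP[x0 x1] := x01.
have Y0 : 0 < Y by exact: lt_le_trans xY.
have f0 := phi_gt0 x01; have f2 := phi_sqr x01.
have nn0 : 0 < n%:R :> R by rewrite ltr0n.
have ni0 : 0 < n%:R^-1 :> R by rewrite invr_gt0.
set i : R := n%:R^-1 in ni0 *.
have i2 : i ^+ 2 <= 4 * Y.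
  have -> : i ^+ 2 = 4 * (4 * n%:R ^+ 2)^-1 by rewrite /i; field; rewrite gt_eqF.
  by rewrite ler_pM2l.
have f2Y : phi x ^+ 2 <= Y by rewrite f2; nra.
have fi : phi x * i <= 2 * Y.
  have p0 : 0 <= phi x * i by rewrite mulr_ge0 ?ltW.
  have q0 : 0 <= 2 * Y by rewrite mulr_ge0 ?ltW.
  rewrite -ler_sqr ?nnegrE // exprMn.
  have -> : (2 * Y) ^+ 2 = Y * (4 * Y) by ring.
  by rewrite ler_pM ?sqr_ge0.
have key : phi x `^ lambda * (phi x + i) `^ lambda <= 9 * Y `^ lambda.
  have f0' := ltW f0; have i0' := ltW ni0; have Y0' := ltW Y0.
  rewrite -powRM ?addr_ge0 //; apply: (@le_trans _ _ ((3 * Y) `^ lambda)).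
    apply: ler_powR_base => //; first by rewrite mulr_ge0 // addr_ge0.
    by rewrite mulrDr -expr2; lra.
  rewrite powRM //; apply: ler_wpM2r; first exact: powR_ge0.
  have := @powR_le_sqr 3 lambda; lra.
have fi0 : 0 < (phi x + i) `^ lambda by rewrite powR_gt0 // addr_gt0.
have Yl0 : 0 < Y `^ lambda by rewrite powR_gt0.
have phiE : x * (1 - x) = phi_pow (2 - lambda) x * phi x `^ lambda.
  rewrite -f2 /phi_pow -powRD; last by rewrite (gt_eqF f0) implybT.
  by rewrite subrK powR_mulrn // ltW.
rewrite phiE powRN /rate -/i.
have F0 : 0 <= phi_pow (2 - lambda) x / n%:R ^+ 2 by rewrite divr_ge0 ?powR_ge0 ?sqr_ge0.
have -> : (Y `^ lambda)^-1 * (phi_pow (2 - lambda) x * phi x `^ lambda / n%:R ^+ 2) =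
  phi_pow (2 - lambda) x / n%:R ^+ 2 * (phi x `^ lambda / Y `^ lambda).
  by field; rewrite !gt_eqF.
have -> : 9 * (phi_pow (2 - lambda) x / (n%:R ^+ 2 * (phi x + i) `^ lambda)) =
  phi_pow (2 - lambda) x / n%:R ^+ 2 * (9 / (phi x + i) `^ lambda).
  by field; rewrite !gt_eqF.
apply: ler_wpM2l => //.
by rewrite ler_pdivrMr // mulrAC ler_pdivlMr.
Qed.

(** This close to 0 one has phi <= 1/n, so phi + 1/n is comparable to 1/n and the rate to
    (phi/n)^(2-lambda). *)
Lemma endpoint_rate lambda n x : 0 <= lambda < 2 -> (0 < n)%N -> 0 < x ->
  x < (4 * n%:R ^+ 2)^-1 ->
  (4 * n%:R ^+ 2)^-1 `^ (1 - lambda / 2) * x `^ (1 - lambda / 2) <= 9 * rate lambda n x.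
Proof.
move=> /andP[l0 l2] n0 x0 xn; have x0' := ltW x0.
have nn0 : 0 < n%:R :> R by rewrite ltr0n.
have ni0 : 0 < n%:R^-1 :> R by rewrite invr_gt0.
have n1 : 1 <= n%:R ^+ 2 :> R by rewrite exprn_ege1 // ler1n.
have x4 : x < 1 / 4.
  by rewrite (lt_le_trans xn) // div1r lef_pV2 ?posrE ?mulr_gt0 ?exprn_gt0 // ler_peMr.
have x01 : 0 < x < 1 by apply/andP; split; lra.
have f0 := phi_gt0 x01; have f2 := phi_sqr x01.
have nE : (4 * n%:R ^+ 2)^-1 = (n%:R^-1) ^+ 2 / 4 :> R by field; rewrite gt_eqF.
set i : R := n%:R^-1 in ni0 nE *.
have fi : phi x <= i.
  rewrite -ler_sqr ?nnegrE ?(ltW f0) ?(ltW ni0) // f2.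
  rewrite nE in xn; have : 0 <= i ^+ 2 by exact: sqr_ge0.
  by nra.
have i0 := ltW ni0.
rewrite nE -powRM ?divr_ge0 ?sqr_ge0 //.
have be0 : 0 <= 1 - lambda / 2 by lra.
apply: (@le_trans _ _ (((phi x * i) ^+ 2) `^ (1 - lambda / 2))).
  apply: ler_powR_base => //; first by rewrite mulr_ge0 // divr_ge0 ?sqr_ge0.
  rewrite exprMn f2 mulrC; have i20 : 0 <= i ^+ 2 by exact: sqr_ge0.
  have -> : x * (i ^+ 2 / 4) = x / 4 * i ^+ 2 by ring.
  by apply: ler_wpM2r => //; nra.
have pi0 : 0 <= phi x * i by rewrite mulr_ge0 // ltW.
rewrite -powR_mulrn // -powRrM.
have -> : 2%:R * (1 - lambda / 2) = 2 - lambda by field.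
have f0' := ltW f0.
rewrite powRM // [i `^ (2 - lambda)]powRB; last by rewrite (gt_eqF ni0) implybT.
rewrite powR_mulrn // /rate -/i -/(phi_pow _ x).
have il0 : 0 < i `^ lambda by exact: powR_gt0.
have fi0 : 0 < (phi x + i) `^ lambda by rewrite powR_gt0 // addr_gt0.
have key : (phi x + i) `^ lambda <= 9 * i `^ lambda.
  apply: (@le_trans _ _ ((2 * i) `^ lambda)).
    by apply: ler_powR_base => //; [rewrite addr_ge0 // ltW|lra].
  rewrite powRM ?(ltW ni0) //; apply: ler_wpM2r; first exact: powR_ge0.
  have := @powR_le_sqr 2 lambda; lra.
have F0 : 0 <= phi_pow (2 - lambda) x / n%:R ^+ 2 by rewrite divr_ge0 ?powR_ge0 ?sqr_ge0.
have -> : phi_pow (2 - lambda) x * (i ^+ 2 / i `^ lambda) =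
  phi_pow (2 - lambda) x / n%:R ^+ 2 * (i `^ lambda)^-1.
  by rewrite {1}/i; field; rewrite !gt_eqF.
have -> : 9 * (phi_pow (2 - lambda) x / (n%:R ^+ 2 * (phi x + i) `^ lambda)) =
  phi_pow (2 - lambda) x / n%:R ^+ 2 * (9 / (phi x + i) `^ lambda).
  by field; rewrite !gt_eqF.
apply: ler_wpM2l => //.
by rewrite ler_pdivlMr // mulrC ler_pdivrMr.
Qed.

(** A parabola above the barrier: under a mean with barycentre x the linear term disappears and the
    square becomes the second moment. The constant [k0] pays for x below 1/(4n^2), where the scale Y
    is no longer x. *)
Lemma barrier_upper lambda n x (Y := Num.max x (4 * n%:R ^+ 2)^-1) :
  0 <= lambda < 2 -> (0 < n)%N -> 0 < x < 1 ->
  exists p ka k0, [/\ 0 <= ka, ka * (x * (1 - x) / n%:R ^+ 2) <= 18 * rate lambda n x,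
    k0 <= 9 * rate lambda n x &
    forall t, 0 <= t <= 1 ->
      barrier lambda Y t <= barrier lambda Y x + p * (t - x) + ka * (t - x) ^+ 2 + k0].
Proof.
move=> l02 n0 x01; have /andP[x0 x1] := x01; have /andP[l0 l2] := l02.
have xY : x <= Y by rewrite /Y le_max lexx.
have nY : (4 * n%:R ^+ 2)^-1 <= Y by rewrite /Y le_max lexx orbT.
have Y0 : 0 < Y by exact: lt_le_trans xY.
have Y0' := ltW Y0; have x0' := ltW x0.
have := barrier_rate l02 n0 x01 xY nY; set Yl := Y `^ (- lambda) => T1.
have Yl0 : 0 < Yl by exact: powR_gt0.
have T0 := rate_ge0 lambda n x; set T := rate lambda n x in T0 T1 *.
have ka0 : 0 <= 2 * Yl by rewrite mulr_ge0 ?ltW.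
have kaT : 2 * Yl * (x * (1 - x) / n%:R ^+ 2) <= 18 * T by rewrite -mulrA; lra.
have YE : Y = x \/ (x < (4 * n%:R ^+ 2)^-1 /\ Y = (4 * n%:R ^+ 2)^-1).
  rewrite /Y; have [h|h] := leP (4 * n%:R ^+ 2)^-1 x; [left|right] => //.
rewrite /barrier -/Yl; case: ifP => [l1|/negbT]; last rewrite -ltNge => l1.
  set Z := Y `^ _; set sY := Num.sqrt Y.
  have sY2 : sY ^+ 2 = Y by rewrite sqr_sqrtr.
  have ZE : Z = Yl * sY.
    rewrite /sY -powR12_sqrt // -powRD; last by rewrite (gt_eqF Y0) implybT.
    by congr (_ `^ _); field.
  (* By sqrt(Yt) <= (Y+t)/2 the term in t^(3/2) has a quadratic majorant. The slope is that of the
     whole majorant at x, and [k0] is the gap at x. *)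
  exists (Yl * (2 * x) + Yl / 2 * (2 * x + Y)), (2 * Yl), (Yl / 2 * (x ^+ 2 + x * Y) - Z * (x * Num.sqrt x)).
  split=> //.
    case: YE => [Yx|[xn YN]].
      have sx2 : Num.sqrt x ^+ 2 = x by rewrite sqr_sqrtr.
      have -> : Z * (x * Num.sqrt x) = Yl * x * Num.sqrt x ^+ 2 by rewrite ZE /sY Yx; ring.
      rewrite sx2 Yx.
      have -> : Yl / 2 * (x ^+ 2 + x * x) - Yl * x * x = 0 by field.
      by rewrite mulr_ge0.
    have Zx : 0 <= Z * (x * Num.sqrt x) by rewrite !mulr_ge0 ?sqrtr_ge0 // powR_ge0.
    have x4 : x < 1 / 4.
      have n1 : 1 <= n%:R ^+ 2 :> R by rewrite exprn_ege1 // ler1n.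
      rewrite (lt_le_trans xn) // div1r lef_pV2 ?posrE ?mulr_gt0 ?exprn_gt0 ?ltr0n //.
      by rewrite ler_peMr.
    have h1 : Yl / 2 * (x ^+ 2 + x * Y) <= Yl * (x * Y).
      have : Yl * (x * x) <= Yl * (x * Y).
        by apply: ler_wpM2l; [exact: ltW|apply: ler_wpM2l].
      by rewrite expr2; lra.
    have h2 : Yl * (x * Y) <= Yl * (x * (1 - x) / n%:R ^+ 2).
      apply: ler_wpM2l; first exact: ltW.
      rewrite -[X in _ <= X]mulrA; apply: ler_wpM2l => //.
      rewrite YN invfM; apply: ler_wpM2r; first by rewrite invr_ge0 sqr_ge0.
      by lra.
    by lra.
  move=> t /andP[t0 t1].
  have am : sY * Num.sqrt t <= (Y + t) / 2.
    have st2 : Num.sqrt t ^+ 2 = t by rewrite sqr_sqrtr.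
    have := sqr_ge0 (sY - Num.sqrt t).
    have -> : (sY - Num.sqrt t) ^+ 2 = sY ^+ 2 + Num.sqrt t ^+ 2 - 2 * (sY * Num.sqrt t) by ring.
    by rewrite sY2 st2; lra.
  have h1 : Z * (t * Num.sqrt t) <= Yl * t * ((Y + t) / 2).
    have -> : Z * (t * Num.sqrt t) = Yl * t * (sY * Num.sqrt t) by rewrite ZE; ring.
    by rewrite ler_wpM2l // mulr_ge0 // ltW.
  have h2 : 0 <= Yl * (t - x) ^+ 2 by rewrite mulr_ge0 ?sqr_ge0 // ltW.
  apply: (@le_trans _ _ (Yl * t ^+ 2 + Yl * t * ((Y + t) / 2))); first by rewrite lerD2l.
  rewrite -subr_ge0.
  have -> : forall u : R, Yl * x ^+ 2 + u + (Yl * (2 * x) + Yl / 2 * (2 * x + Y)) * (t - x) +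
     2 * Yl * (t - x) ^+ 2 + (Yl / 2 * (x ^+ 2 + x * Y) - u) - (Yl * t ^+ 2 + Yl * t * ((Y + t) / 2)) =
     1 / 2 * (Yl * (t - x) ^+ 2) by move=> u; field.
  by rewrite mulr_ge0.
set be := 1 - lambda / 2; set Z := Y `^ be.
have be01 : 0 < be <= 1 by apply/andP; rewrite /be; split; lra.
have Z0 : 0 < Z by exact: powR_gt0.
case: YE => [Yx|[xn YN]].
  (* At the scale Y = x, [powR_lower] at t/x bounds the singular term by its tangent plus a square,
     with no constant left over. *)
  exists (Yl * (2 * x) - Yl * be * x), (2 * Yl), 0; split=> //; first by rewrite mulr_ge0.
  move=> t /andP[t0 t1]; rewrite !ger0_norm //.
  have tE : t = x * (t / x) by rewrite mulrCA mulfV ?mulr1 // gt_eqF.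
  have s0 : 0 <= t / x by rewrite divr_ge0.
  have := powR_lower s0 be01.
  have Zx : Z * x `^ be = Yl * x ^+ 2.
    rewrite /Z /Yl Yx -powRD; last by rewrite (gt_eqF x0) implybT.
    rewrite -(powR_mulrn 2 x0') -powRD; last by rewrite (gt_eqF x0) implybT.
    by congr (_ `^ _); rewrite /be; field.
  have -> : t `^ be = x `^ be * (t / x) `^ be by rewrite -powRM // -tE.
  move=> low.
  have h1 : Z * x `^ be * (1 + be * (t / x - 1) - (t / x - 1) ^+ 2) <= Z * (x `^ be * (t / x) `^ be).
    by rewrite mulrA; apply: ler_wpM2l => //; rewrite Zx mulr_ge0 ?sqr_ge0 // ltW.
  have h2 : Z * x `^ be * (1 + be * (t / x - 1) - (t / x - 1) ^+ 2) =
     Z * x `^ be + Yl * be * x * (t - x) - Yl * (t - x) ^+ 2.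
    by rewrite Zx; field; rewrite gt_eqF.
  have -> : Yl * t ^+ 2 = Yl * x ^+ 2 + Yl * (2 * x) * (t - x) + Yl * (t - x) ^+ 2 by ring.
  by rewrite h2 in h1; lra.
(* The singular term at t is nonpositive and is dropped; its size at x is the constant, which
   [endpoint_rate] controls. *)
exists (Yl * (2 * x)), (2 * Yl), (Z * x `^ be); split=> //.
  by rewrite /Z YN; exact: endpoint_rate.
move=> t /andP[t0 t1]; rewrite !ger0_norm //.
have h1 : 0 <= Z * t `^ be by rewrite mulr_ge0 ?powR_ge0 // ltW.
have h2 : 0 <= Yl * (t - x) ^+ 2 by rewrite mulr_ge0 ?sqr_ge0 // ltW.
have -> : Yl * t ^+ 2 = Yl * x ^+ 2 + Yl * (2 * x) * (t - x) + Yl * (t - x) ^+ 2 by ring.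
lra.
Qed.
End BarrierUpper.

(** * Error of a positive mean in terms of the modulus *)

Section MeanError.
Variable R : realType.

Lemma phi_pow_sqr (lambda u : R) : 0 < u < 1 ->
  phi_pow lambda u ^+ 2 = u `^ lambda * (1 - u) `^ lambda.
Proof.
move=> u01; have /andP[u0 u1] := u01; have f0 := ltW (phi_gt0 u01).
rewrite /phi_pow expr2 -powRM // -expr2 phi_sqr // powRM //; first exact: ltW.
by rewrite subr_ge0 ltW.
Qed.

Lemma powR_half_ge (lambda z : R) : lambda < 2 -> 0 <= lambda -> 1 / 2 <= z -> 1 / 4 <= z `^ lambda.
Proof.
move=> l2 l0 hz; apply: (@le_trans _ _ ((1 / 2) `^ lambda)).
  have -> : 1 / 4 = (1 / 2) `^ 2%:R :> R by rewrite powR_mulrn ?divr_ge0 //; field.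
  by apply: ger_powR; [apply/andP; split; lra|exact: ltW].
by apply: ler_powR_base => //; rewrite divr_ge0.
Qed.

(** The step h phi^lambda degenerates at both endpoints, hence a reflected copy with its own scale.
    In the normalisation 144 = 36 * 4: the 36 is that of [barrier_diff2], the 4 bounds the inverse
    of the power at the farther endpoint. *)
Definition barrier_pair lambda (h Y Y' u : R) : R :=
  (barrier lambda Y u + barrier lambda Y' (1 - u)) / ((1 - lambda / 2) ^+ 2 / 144 * h ^+ 2).

Lemma barrier_pair_continuous lambda (h Y Y' : R) : lambda < 2 ->
  continuous (barrier_pair lambda h Y Y').
Proof.
move=> l2 z; apply: cvgM; last exact: cvg_cst.
apply: cvgD; first exact: barrier_continuous.
apply: (@continuous_comp _ _ _ (fun u : R => 1 - u) (barrier lambda Y')).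
  by apply: cvgB; [exact: cvg_cst|exact: cvg_id].
exact: barrier_continuous.
Qed.

Lemma barrier_pair_low lambda (h Y Y' u d : R) : 0 <= lambda < 2 -> 0 < h -> 0 < Y -> 0 < Y' ->
  0 < d -> 0 <= u - d -> u + d <= 1 ->
  0 <= diff2 (barrier_pair lambda h Y Y') u d /\
  (d = h * phi_pow lambda u -> 1 <= diff2 (barrier_pair lambda h Y Y') u d).
Proof.
move=> l02 h0 Y0 Y0' d0 h1 h2; have /andP[l0 l2] := l02.
have u01 : 0 < u < 1 by apply/andP; split; lra.
have du : 0 < d <= u by rewrite d0; lra.
have du' : 0 < d <= 1 - u by rewrite d0; lra.
have := barrier_diff2 l02 Y0' du'; have := barrier_diff2 l02 Y0 du.
set c := (1 - lambda / 2) ^+ 2 => L0 L1.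
have c0 : 0 < c by rewrite exprn_gt0 //; lra.
have low z : 0 <= c / 36 * (d ^+ 2 * z `^ (- lambda)).
  by rewrite mulr_ge0 // mulr_ge0 ?sqr_ge0 ?powR_ge0 // divr_ge0 // ltW.
have M0 := low u; have M1 := low (1 - u).
have K0 : 0 < c / 144 * h ^+ 2.
  by apply: mulr_gt0; [apply: divr_gt0|exact: exprn_gt0].
have -> : diff2 (barrier_pair lambda h Y Y') u d =
   ((barrier lambda Y (u + d) - 2 * barrier lambda Y u + barrier lambda Y (u - d)) +
   (barrier lambda Y' (1 - u + d) - 2 * barrier lambda Y' (1 - u) + barrier lambda Y' (1 - u - d)))
    / (c / 144 * h ^+ 2).
  rewrite /diff2 /barrier_pair -/c; have -> : 1 - (u + d) = 1 - u - d by ring.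
  have -> : 1 - (u - d) = 1 - u + d by ring.
  by field; rewrite !gt_eqF.
move: L0 L1; set D0 := barrier _ _ _ - _ + _; set D1 := barrier _ _ _ - _ + _.
move: D0 D1 => D0 D1 L0 L1; clear low; split.
  by apply: divr_ge0; [lra|exact: ltW].
move=> dE; rewrite ler_pdivlMr // mul1r.
have d2 : d ^+ 2 = h ^+ 2 * (u `^ lambda * (1 - u) `^ lambda) by rewrite dE exprMn phi_pow_sqr.
have /andP[u0 u1] := u01.
have u0' : u `^ lambda != 0 by rewrite gt_eqF // powR_gt0.
have u1' : (1 - u) `^ lambda != 0 by rewrite gt_eqF // powR_gt0 // subr_gt0.
have KE z : 1 / 4 <= z -> c / 144 * h ^+ 2 <= c / 36 * (h ^+ 2 * z).
  move=> hz; have -> : c / 144 * h ^+ 2 = c / 36 * (h ^+ 2 * (1 / 4)) by field.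
  apply: ler_wpM2l; first by rewrite divr_ge0 // ltW.
  by apply: ler_wpM2l; first exact: sqr_ge0.
have [uh|hu] := leP u (1 / 2).
  have e : d ^+ 2 * u `^ (- lambda) = h ^+ 2 * (1 - u) `^ lambda by rewrite d2 powRN; field.
  have hu : 1 / 2 <= 1 - u by lra.
  by have := KE _ (powR_half_ge l2 l0 hu); rewrite -e => KK; lra.
have e : d ^+ 2 * (1 - u) `^ (- lambda) = h ^+ 2 * u `^ lambda by rewrite d2 powRN; field.
by have := KE _ (powR_half_ge l2 l0 (ltW hu)); rewrite -e => KK; lra.
Qed.

Lemma quadratic_mean (b : R -> R) (y p k1 k2 V T C : R) N (w s : nat -> R) :
  0 <= k1 -> 0 <= C -> k1 * V <= 18 * T -> k2 <= 9 * T ->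
  (forall i, 0 <= w i) -> \sum_(i < N) w i = 1 -> \sum_(i < N) w i * s i = y ->
  \sum_(i < N) w i * (s i - y) ^+ 2 <= C * V ->
  (forall i, (i < N)%N -> b (s i) <= b y + p * (s i - y) + k1 * (s i - y) ^+ 2 + k2) ->
  \sum_(i < N) w i * b (s i) <= b y + (18 * C + 9) * T.
Proof.
move=> k10 C0 k1T k2T w0 w1 wy wv hb.
apply: (@le_trans _ _ (\sum_(i < N) w i * (b y + p * (s i - y) + k1 * (s i - y) ^+ 2 + k2))).
  by apply: ler_sum => i _; apply: ler_wpM2l => //; exact: hb.
rewrite (eq_bigr (fun i : 'I_N => w i * (b y + k2 - p * y) + p * (w i * s i) +
  k1 * (w i * (s i - y) ^+ 2))); last by move=> i _; ring.
rewrite !big_split /= -mulr_suml -!mulr_sumr w1 wy mul1r.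
have : k1 * \sum_(i < N) w i * (s i - y) ^+ 2 <= C * (k1 * V).
  by rewrite (mulrCA C); apply: ler_wpM2l.
have : C * (k1 * V) <= C * (18 * T) by apply: ler_wpM2l.
by lra.
Qed.

Lemma barrier_pair_mean (lambda h x C : R) (n N : nat) (w t : nat -> R) :
  0 <= lambda < 2 -> 0 < h -> 0 < x < 1 -> (0 < n)%N -> 0 <= C ->
  (forall i, 0 <= w i) -> (forall i, (i < N)%N -> 0 <= t i <= 1) ->
  \sum_(i < N) w i = 1 -> \sum_(i < N) w i * t i = x ->
  \sum_(i < N) w i * (t i - x) ^+ 2 <= C * (x * (1 - x) / n%:R ^+ 2) ->
  exists Y Y', [/\ 0 < Y, 0 < Y' &
  \sum_(i < N) w i * barrier_pair lambda h Y Y' (t i) - barrier_pair lambda h Y Y' x <=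
  288 * (18 * C + 9) / (1 - lambda / 2) ^+ 2 * (rate lambda n x / h ^+ 2)].
Proof.
move=> l02 h0 x01 n0 C0 w0 t01 w1 wx wv.
have y01 : 0 < 1 - x < 1 by apply/andP; split; lra.
have [p [ka [k0 [ka0 kaT k0T]]]] := barrier_upper l02 n0 x01.
have [p' [ka' [k0' [ka0' kaT' k0T']]]] := barrier_upper l02 n0 y01.
have xxE : (1 - x) * (1 - (1 - x)) = x * (1 - x) by ring.
have rateE : rate lambda n (1 - x) = rate lambda n x by rewrite /rate /phi_pow /phi xxE.
rewrite rateE xxE in kaT' k0T'.
set Y := Num.max x _; set Y' := Num.max (1 - x) _ => up' up.
exists Y, Y'; split.
- by rewrite /Y lt_max; case/andP: x01 => ->.
- by rewrite /Y' lt_max; case/andP: y01 => ->.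
move: Y Y' up up' => Y Y' up up'.
set T := rate lambda n x in kaT kaT' k0T k0T' *.
have S0 := quadratic_mean ka0 C0 kaT k0T w0 w1 wx wv (fun i iN => up _ (t01 i iN)).
have S1 : \sum_(i < N) w i * barrier lambda Y' (1 - t i) <= barrier lambda Y' (1 - x) + (18 * C + 9) * T.
  apply: (@quadratic_mean _ _ p' ka' k0' (x * (1 - x) / n%:R ^+ 2) _ _ _ _ (fun i => 1 - t i)) => //.
  - rewrite (eq_bigr (fun i : 'I_N => w i - w i * t i)); last by move=> i _; ring.
    by rewrite sumrB w1 wx.
  - rewrite (eq_bigr (fun i : 'I_N => w i * (t i - x) ^+ 2)) //; move=> i _; ring.
  - by move=> i iN; apply: up'; have /andP[? ?] := t01 i iN; apply/andP; split; lra.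
have c0 : 0 < (1 - lambda / 2) ^+ 2 by case/andP: l02 => ? ?; rewrite exprn_gt0 //; lra.
rewrite /barrier_pair; move: c0; move: ((1 - lambda / 2) ^+ 2) => c c0.
rewrite (eq_bigr (fun i : 'I_N => (w i * barrier lambda Y (t i) + w i * barrier lambda Y' (1 - t i))
  / (c / 144 * h ^+ 2))); last by move=> i _; rewrite mulrA mulrDr.
rewrite -mulr_suml big_split /=; move: S0 S1.
move: (\sum_(i < N) w i * barrier _ _ (t i)) (\sum_(i < N) w i * barrier _ _ (1 - t i)) => A0 A1.
move: (barrier _ _ x) (barrier _ _ (1 - x)) => B0 B1 S0 S1.
rewrite -mulrBl ler_pdivrMr; last by rewrite mulr_gt0 ?divr_gt0 ?exprn_gt0.
(* Two barriers, each losing (18C+9) times the rate, divided by the normalisation with 144: whence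
   288. *)
have -> : 288 * (18 * C + 9) / c * (T / h ^+ 2) * (c / 144 * h ^+ 2) = 2 * (18 * C + 9) * T.
  by field; rewrite !gt_eqF.
by move: ((18 * C + 9) * T) (mulrA 2 (18 * C + 9) T) S0 S1 => z <- S0 S1; lra.
Qed.

(** [comparison] on each subinterval around x is the chord condition that [mean_bound] needs for g -
    W v. *)
Lemma one_sided_error (g v s : R -> R) (W x : R) N (w t : nat -> R) :
  cont01 g -> continuous v -> 0 < W -> 0 < x < 1 ->
  (forall u, 0 < u < 1 -> 0 < s u) ->
  (forall u d, 0 < u < 1 -> 0 < d <= s u -> 0 <= u - d -> u + d <= 1 -> diff2 g u d < W) ->
  (forall u d, 0 < d -> 0 <= u - d -> u + d <= 1 -> 0 <= diff2 v u d) ->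
  (forall u, 0 < u < 1 -> 0 <= u - s u -> u + s u <= 1 -> 1 <= diff2 v u (s u)) ->
  (forall i, 0 <= w i) -> (forall i, (i < N)%N -> 0 <= t i <= 1) ->
  \sum_(i < N) w i = 1 -> \sum_(i < N) w i * t i = x ->
  \sum_(i < N) w i * g (t i) - g x <= W * (1 + (\sum_(i < N) w i * v (t i) - v x)).
Proof.
move=> cg cv W0 x01 s0 hg v0 v1 w0 t01 w1 wx.
suff chord t1 t2 : 0 <= t1 -> t1 < x < t2 -> t2 <= 1 ->
    (t2 - x) * (g t1 - W * v t1) + (x - t1) * (g t2 - W * v t2) <=
    (t2 - t1) * (g x - W * v x + W).
  have := @mean_bound R (fun u => g u - W * v u) W x N w t (ltW W0) x01 chord w0 t01 w1 wx.
  have -> : \sum_(i < N) w i * (g (t i) - W * v (t i)) =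
      \sum_(i < N) w i * g (t i) - W * \sum_(i < N) w i * v (t i).
    by rewrite mulr_sumr -sumrB; apply: eq_bigr => i _; ring.
  by lra.
move=> t10 xt t21.
have sub : `[t1, t2] `<=` `[0, 1].
  by move=> z /=; rewrite !in_itv /= => /andP[z1 z2]; rewrite (le_trans t10 z1) (le_trans z2 t21).
have in01 u : t1 < u < t2 -> 0 < u < 1.
  by move=> /andP[a1 a2]; rewrite (le_lt_trans t10 a1) (lt_le_trans a2 t21).
apply: (@comparison R g v s W t1 t2) xt => //.
- exact: continuous_subspaceW sub cg.
- exact: continuous_subspaceT.
- by move=> u /in01; exact: s0.
- by move=> u d /in01 u01 dh a1 a2; apply: hg => //; [exact: le_trans a1|exact: le_trans a2 _].
- by move=> u d d0 a1 a2; apply: v0 => //; [exact: le_trans a1|exact: le_trans a2 _].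
- by move=> u /in01 u01 a1 a2; apply: v1 => //; [exact: le_trans a1|exact: le_trans a2 _].
Qed.

Lemma mean_error (f : R -> R) (lambda h x C : R) (n N : nat) (w t : nat -> R) :
  cont01 f -> 0 <= lambda < 2 -> 0 < h -> 0 < x < 1 -> (0 < n)%N -> 0 <= C ->
  (forall i, 0 <= w i) -> (forall i, (i < N)%N -> 0 <= t i <= 1) ->
  \sum_(i < N) w i = 1 -> \sum_(i < N) w i * t i = x ->
  \sum_(i < N) w i * (t i - x) ^+ 2 <= C * (x * (1 - x) / n%:R ^+ 2) ->
  `|f x - \sum_(i < N) w i * f (t i)| <=
  (1 + 288 * (18 * C + 9) / (1 - lambda / 2) ^+ 2 * (rate lambda n x / h ^+ 2)) *
  omega2 (phi_pow lambda) f h.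
Proof.
move=> cf l02 h0 x01 n0 C0 w0 t01 w1 wx wv; have /andP[l0 l2] := l02.
have [Y [Y' [Y0 Y0']]] := barrier_pair_mean l02 h0 x01 n0 C0 w0 t01 w1 wx wv.
set E := 288 * _ / _ * _ => Ev.
have E0 : 0 <= E.
  apply: mulr_ge0; last by rewrite divr_ge0 ?rate_ge0 ?sqr_ge0.
  apply: divr_ge0; last exact: sqr_ge0.
  by rewrite mulr_ge0 // addr_ge0 // mulr_ge0.
set om := omega2 _ _ _; have om0 : 0 <= om by exact: omega2_ge0.
have s0 u : 0 < u < 1 -> 0 < h * phi_pow lambda u.
  by move=> u01; rewrite mulr_gt0 // powR_gt0 // phi_gt0.
have v0 u d (d0 : 0 < d) h1 h2 := (@barrier_pair_low lambda h Y Y' u d l02 h0 Y0 Y0' d0 h1 h2).1.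
have v1 u (u01 : 0 < u < 1) h1 h2 :=
  (@barrier_pair_low lambda h Y Y' u _ l02 h0 Y0 Y0' (s0 u u01) h1 h2).2 erefl.
have cv := @barrier_pair_continuous lambda h Y Y' l2.
have B0 : 0 < 1 + E by rewrite ltr_wpDr.
(* The comparison asks for a positive [W] strictly above the differences. The modulus may vanish or
   be attained, so it is enlarged by an arbitrary e > 0. *)
rewrite mulrC -ler_pdivrMr //; apply/ler_addgt0Pr => e e0; rewrite ler_pdivrMr //.
have W0 : 0 < om + e by rewrite ltr_wpDl.
have hf u d : 0 < u < 1 -> 0 < d <= h * phi_pow lambda u -> 0 <= u - d -> u + d <= 1 ->
    `|diff2 f u d| < om + e.
  move=> u01 /andP[d0 dh] a1 a2.
  by apply: (le_lt_trans (omega2_ge cf u01 d0 dh a1 a2)); rewrite ltrDl.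
have WE : (om + e) * (1 + (\sum_(i < N) w i * barrier_pair lambda h Y Y' (t i) -
    barrier_pair lambda h Y Y' x)) <= (om + e) * (1 + E).
  by apply: ler_wpM2l; [exact: ltW|rewrite lerD2l].
have h1 := one_sided_error cf cv W0 x01 s0
  (fun u d a b c1 c2 => le_lt_trans (ler_norm _) (hf u d a b c1 c2)) v0 v1 w0 t01 w1 wx.
have cNf : cont01 (fun u => - f u) by move=> z; apply: cvgN; exact: cf.
have hNf u d : 0 < u < 1 -> 0 < d <= h * phi_pow lambda u -> 0 <= u - d -> u + d <= 1 ->
    diff2 (fun u => - f u) u d < om + e.
  move=> a b c1 c2; have -> : diff2 (fun u => - f u) u d = - diff2 f u d by rewrite /diff2; ring.
  by apply: le_lt_trans (hf u d a b c1 c2); rewrite -normrN; exact: ler_norm.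
have h2 := one_sided_error cNf cv W0 x01 s0 hNf v0 v1 w0 t01 w1 wx.
have e2 : \sum_(i < N) w i * - f (t i) = - \sum_(i < N) w i * f (t i).
  by rewrite -sumrN; apply: eq_bigr => i _; rewrite mulrN.
rewrite e2 in h2; have {}h1 := le_trans h1 WE; have {}h2 := le_trans h2 WE.
move: h1 h2; move: (\sum_(i < N) w i * f (t i)) (f x) ((om + e) * (1 + E)) => A B D h1 h2.
by rewrite ler_norml; apply/andP; split; lra.
Qed.
End MeanError.

(** * The operator and its error estimate *)

Section OperatorError.
Variable R : realType.

Lemma node_in01 (N i : nat) : (0 < N)%N -> (i <= N)%N -> 0 <= (i%:R / N%:R : R) <= 1.
Proof.
move=> N0 iN; apply/andP; split; first by rewrite divr_ge0.
by rewrite ler_pdivrMr ?ltr0n // mul1r ler_nat.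
Qed.

Lemma shape_op_error q n N (C : R) T (f : R -> R) (lambda h x : R) :
  shape_op q n N C T -> 0 <= C -> (0 < N)%N -> (0 < n)%N -> cont01 f ->
  0 <= lambda < 2 -> 0 < h -> 0 < x < 1 ->
  `|f x - (T (bern N (fun i => f (i%:R / N%:R)))).[x]| <=
  (1 + 288 * (18 * C + 9) / (1 - lambda / 2) ^+ 2 * (rate lambda n x / h ^+ 2)) *
  omega2 (phi_pow lambda) f h.
Proof.
move=> sT C0 N0 n0 cf l02 h0 x01; have /andP[x0 x1] := x01.
have x01' : 0 <= x <= 1 by rewrite !ltW.
have [w w0 wE] := shape_op_weights sT x01'.
pose t i : R := i%:R / N%:R.
have t01 i : (i < N.+1)%N -> 0 <= t i <= 1 by move=> iN; exact: node_in01.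
have w1 : \sum_(i < N.+1) w i = 1.
  have := wE (fun=> 1); rewrite bern_const (so_const sT) hornerC => ->.
  by apply: eq_bigr => i _; rewrite mulr1.
have wx : \sum_(i < N.+1) w i * t i = x.
  by rewrite -(wE t) bern_X // (so_X sT) hornerX.
have [mu muC muE] := so_X1X sT.
have wtt : \sum_(i < N.+1) w i * (t i * (1 - t i)) = mu * (x * (1 - x)).
  rewrite -(wE (fun i => t i * (1 - t i))) bern_X1X // muE.
  by rewrite hornerZ hornerM hornerD hornerN hornerX hornerC.
(* By (t-x)^2 = (1-2x)t + x^2 - t(1-t), the second moment is decided by the eigenvalue on x(1-x). *)
have wv : \sum_(i < N.+1) w i * (t i - x) ^+ 2 <= C * (x * (1 - x) / n%:R ^+ 2).
  rewrite (eq_bigr (fun i : 'I_N.+1 => (1 - 2 * x) * (w i * t i) + x ^+ 2 * w i -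
    w i * (t i * (1 - t i)))); last by move=> i _; ring.
  rewrite sumrB big_split /= -!mulr_sumr wx w1 wtt.
  have -> : (1 - 2 * x) * x + x ^+ 2 * 1 - mu * (x * (1 - x)) = (1 - mu) * (x * (1 - x)) by ring.
  have -> : C * (x * (1 - x) / n%:R ^+ 2) = C / n%:R ^+ 2 * (x * (1 - x)) by ring.
  by apply: ler_wpM2r => //; rewrite mulr_ge0 ?subr_ge0 // ltW.
by rewrite wE; exact: (mean_error cf l02 h0 x01 n0 C0 w0 t01 w1 wx wv).
Qed.
End OperatorError.

Theorem theorem1p1 (R : realType) :
  exists c0 : R, 0 < c0 /\
  forall q : nat,
  exists c : R -> R,
  forall n : nat, (0 < n)%N ->
  exists M : (R -> R) -> {poly R},
    [/\ linear_on_C01 M,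
        positive_on_C01 M,
        (forall f : R -> R, cont01 f -> (size (M f) <= n.+1)%N),
        (forall (k : nat) (f : R -> R), (k <= q)%N -> kmonotone k f ->
           kmonotone k (fun x => (M f).[x])) &
        forall lambda1 : R, lambda1 < 2 ->
        forall (lambda : R) (f : R -> R) (x h : R),
          0 <= lambda -> lambda <= lambda1 -> cont01 f ->
          x \in `[0, 1] -> 0 < h -> h <= c0 ->
          `|f x - (M f).[x]| <=
            c lambda1 *
            (1 + phi_pow (2 - lambda) x /
                 (h ^+ 2 * n%:R ^+ 2 * (phi x + n%:R^-1) `^ lambda)) *
            omega2 (phi_pow lambda) f h].
Proof.
exists 1; split=> // q; have [C [C0 ops]] := shape_op_exists R q.
(* The blow-up (1 - l/2)^-2 comes from the lower bound in [barrier_diff2]. It increases with l on l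
   < 2, so the value at [lambda1] serves every smaller lambda. *)
exists (fun l => 1 + 288 * (18 * C + 9) / (1 - l / 2) ^+ 2) => n n0.
have [N [N0 [T sT]]] := ops n n0.
exists (fun f => T (bern N (fun i => f (i%:R / N%:R)))); split.
- split=> [f g cf cg fg|a f g cf cg].
    by congr (T _); apply: eq_bern => i iN; apply: fg; rewrite in_itv /= node_in01.
  by rewrite bern_linear (so_linear sT).
- move=> f cf f0 x; rewrite in_itv /=; apply: (so_shape sT (k := 0)) => //.
  by apply: bern_ge0 => i iN; apply: f0; rewrite in_itv /= node_in01.
- by move=> f _; exact: (so_size sT).
- move=> k f kq fk; apply: kmonotone_poly; apply: (so_shape sT kq).
  by apply: derivn_bern_ge0 => i ikN; exact: kmonotone_fdiff.
move=> l1 l12 lambda f x h l0 ll1 cf; rewrite in_itv /= => /andP[x0 x1] h0 _.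
have l2 : lambda < 2 by exact: le_lt_trans ll1 l12.
set om := omega2 _ _ _; have om0 : 0 <= om by exact: omega2_ge0.
have A0 : 0 <= 288 * (18 * C + 9) by rewrite mulr_ge0 // addr_ge0 // mulr_ge0.
set r := phi_pow _ _ / _.
have r0 : 0 <= r.
  apply: divr_ge0; first exact: powR_ge0.
  by apply: mulr_ge0; [rewrite mulr_ge0 ?sqr_ge0|exact: powR_ge0].
have c_ge0 : 0 <= 288 * (18 * C + 9) / (1 - l1 / 2) ^+ 2 by rewrite divr_ge0 ?sqr_ge0.
have rhs0 : 0 <= (1 + 288 * (18 * C + 9) / (1 - l1 / 2) ^+ 2) * (1 + r) * om.
  by rewrite !mulr_ge0 // addr_ge0.
set P := T _.
(* The operator interpolates at 0 and 1, where phi vanishes and the interior estimate does not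
   apply. *)
have [xe|xne] := eqVneq x 0.
  have -> : f x - P.[x] = 0 by rewrite xe /P (so_at0 sT) bern0 mul0r subrr.
  by rewrite normr0.
have [xe|xne1] := eqVneq x 1.
  have -> : f x - P.[x] = 0.
    by rewrite xe /P (so_at1 sT) bern1 divff ?subrr // pnatr_eq0 -lt0n.
  by rewrite normr0.
have x01 : 0 < x < 1 by rewrite !lt_neqAle eq_sym xne x0 xne1 x1.
have l02 : 0 <= lambda < 2 by rewrite l0.
apply: (le_trans (shape_op_error sT C0 N0 n0 cf l02 h0 x01)); rewrite -/om.
apply: ler_wpM2r => //.
have -> : rate lambda n x / h ^+ 2 = r.
  by rewrite /rate /r -mulrA -invfM; congr (_ / _); ring.
have cle : 288 * (18 * C + 9) / (1 - lambda / 2) ^+ 2 <= 288 * (18 * C + 9) / (1 - l1 / 2) ^+ 2.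
  have p1 : 0 < 1 - l1 / 2 by lra.
  have p2 : 1 - l1 / 2 <= 1 - lambda / 2 by lra.
  apply: ler_wpM2l => //; rewrite lef_pV2 ?posrE ?exprn_gt0 ?(lt_le_trans p1) //.
  by rewrite ler_pXn2r ?nnegrE // ltW // (lt_le_trans p1).
move: c_ge0 cle; move: (288 * _ / _ ^+ 2) (288 * _ / _ ^+ 2) => c1 c2 c_ge0 cle.
have h1 : c1 * r <= c2 * r by apply: ler_wpM2r.
by rewrite mulrDl mul1r mulrDr mulr1; lra.
Qed.
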